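(* Suppose there exists a constant $p_0>0$ such that for all $j\in\mathcal{J}$, $p_j(\xi)\le p_0$ almost surely. Let $\xi_1,\xi_2,\dots$ be independent identically distributed samples of $\xi$, and for each $\epsilon>0$ and each positive integer $\nu$ let $x^\epsilon_\nu$ be the $x$-component of the unique solution $\big(x,(y(\xi_\ell),\lambda(\xi_\ell))_{\ell=1}^\nu\big)$ of the regularized sample average approximation $$0\le x\ \perp\ Cx-\frac1\nu\sum_{\ell=1}^\nu\lambda(\xi_\ell)+a\ge 0,$$ $$0\le\begin{pmatrix}y(\xi_\ell)\\ \lambda(\xi_\ell)\end{pmatrix}\ \perp\ \begin{pmatrix}\Pi(\xi_\ell)& I\\ -I&\epsilon I\end{pmatrix}\begin{pmatrix}y(\xi_\ell)\\ \lambda(\xi_\ell)\end{pmatrix}+\begin{pmatrix}-p(\xi_\ell)\\ x\end{pmatrix}\ge 0,\quad \ell=1,\dots,\nu .$$ Then, with probability $1$, $$\limsup_{\epsilon\downarrow0}\ \lim_{\nu\to\infty}x^\epsilon_\nu\ \subseteq\ S^*,$$ where $S^*$ denotes the set of first-stage solutions of the two-stage stochastic complementarity problem $$0\le x\ \perp\ Cx-\mathbb{E}[\lambda(\xi)]+a\ge 0,$$ $$0\le\begin{pmatrix}y(\xi)\\ \lambda(\xi)\end{pmatrix}\ \perp\ \begin{pmatrix}\Pi(\xi)& I\\ -I&0\end{pmatrix}\begin{pmatrix}y(\xi)\\ \lambda(\xi)\end{pmatrix}+\begin{pmatrix}-p(\xi)\\ x\end{pmatrix}\ge 0\quad\text{for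 a.e. }\xi\in\Xi.$$
   Context: $J\ge 1$ is an integer and $\mathcal{J}=\{1,\dots,J\}$. $\xi$ is a random vector with support $\Xi\subseteq\mathbb{R}^d$ and induced probability space $(\Xi,\mathcal{F},P)$; ''a.e.'' and ''almost surely'' refer to $P$. $C=\mathrm{diag}(c_1,\dots,c_J)$ with all $c_j>0$; $a=(a_1,\dots,a_J)^T$ with all $a_j>0$. $p(\xi)=(p_1(\xi),\dots,p_J(\xi))^T$ with each $p_j:\Xi\to\mathbb{R}$ measurable. $\gamma:\Xi\to\mathbb{R}_+$ is measurable and there is a constant $\gamma_0>0$ with $\gamma(\xi)\ge\gamma_0$ for a.e. $\xi\in\Xi$. $\Pi(\xi)=\gamma(\xi)(ee^T+I)$, where $e=(1,\dots,1)^T\in\mathbb{R}^J$ and $I$ is the $J\times J$ identity. The notation $0\le u\perp v\ge0$ means $u\ge 0$, $v\ge 0$ componentwise and $u^Tv=0$. In the sample average problem the unknowns are $x\in\mathbb{R}^J$ and vectors $y(\xi_\ell),\lambda(\xi_\ell)\in\mathbb{R}^J$, $\ell=1,\dots,\nu$; it has a unique solution for each $\epsilon>0$ and $\nu$ (almost surely with respect to the samples). A solution of the (unregularized) two-stage problem is a triple $(x,y,\lambda)$ with $x\in\mathbb{R}^J$, $y:\Xi\to\mathbb{R}^J$ essentially bounded measurable, $\lambda:\Xi\to\mathbb{R}^J$ integrable, satisfying the displayed relations; $S^*$ is the set of all $x\in\mathbb{R}^J$ for which there exist such $y,\lambda$ with $(x,y,\lambda)$ a solution. $\limsup_{\epsilon\downarrow0}$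 is the outer (set) limit: the set of all accumulation points, as $\epsilon\downarrow0$, of the points $\lim_{\nu\to\infty}x^\epsilon_\nu$. *)

(* Defs.v *)
From HB Require Import structures.
From mathcomp Require Import all_boot all_order all_algebra.
From mathcomp Require Import finmap.
From mathcomp Require Import all_classical all_reals all_analysis.
Set Implicit Arguments.
Unset Strict Implicit.
Unset Printing Implicit Defensive.
Import Order.TTheory GRing.Theory Num.Theory.
Import numFieldNormedType.Exports.
Local Open Scope classical_set_scope.
Local Open Scope ring_scope.

(* R^d with its Borel sigma-algebra (generated by the open sets of 'rV[R]_d). *)
Definition borel_rV (R : realType) (d : nat) : measurableType _ :=
  g_sigma_algebraType (@open 'rV[R]_d).

(* The topological support of a law on R^d: the smallest closed set of
   probability one. *)
Definition is_support (R : realType) (d : nat)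
    (P : probability (borel_rV R d) R) (Xi : set 'rV[R]_d) : Prop :=
  [/\ closed Xi, P Xi = 1%E &
      forall F : set 'rV[R]_d, closed F -> P F = 1%E -> Xi `<=` F].

(* Mutual independence: the product rule on every finite subfamily. *)
Definition mutually_independent (R : realType) (dO dT : measure_display)
    (Omega : measurableType dO) (T : measurableType dT)
    (Pr : probability Omega R) (X : nat -> {RV Pr >-> T}) : Prop :=
  forall (I : {fset nat}) (A : nat -> set T), (forall i, measurable (A i)) ->
    Pr (\bigcap_(i in [set` I]) (X i @^-1` A i)) =
    (\prod_(i <- I) Pr (X i @^-1` A i))%E.

(* Independent samples, each distributed according to P. *)
Definition iid_samples (R : realType) (dO dT : measure_display)
    (Omega : measurableType dO) (T : measurableType dT)
    (Pr : probability Omega R) (P : probability T R)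
    (X : nat -> {RV Pr >-> T}) : Prop :=
  mutually_independent X /\
  forall (l : nat) (A : set T), measurable A -> distribution Pr (X l) A = P A.

(* 0 <= u _|_ v >= 0 *)
Definition perp (R : realType) (n : nat) (u v : 'cV[R]_n) : Prop :=
  [/\ forall i, 0 <= u i 0, forall i, 0 <= v i 0 & u^T *m v = 0].

(* g (e e^T + I) *)
Definition Pi_mx (R : realType) (J : nat) (g : R) : 'M[R]_J :=
  let e : 'cV[R]_J := const_mx 1 in g *: (e *m e^T + 1%:M).

(* The second-stage complementarity problem in (y, lam) for one realization
   (g, q) of (gamma(xi), p(xi)); eps = 0 is the unregularized problem. *)
Definition second_stage (R : realType) (J : nat) (g : R) (q : 'cV[R]_J)
    (eps : R) (x y lam : 'cV[R]_J) : Prop :=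
  perp (col_mx y lam)
    (block_mx (Pi_mx J g) 1%:M (- 1%:M) eps%:M *m col_mx y lam
     + col_mx (- q) x).

(* The regularized sample average problem for the sample s_0, ..., s_(nu-1). *)
Definition saa_solution (R : realType) (J : nat) (T : Type)
    (c : 'rV[R]_J) (a : 'cV[R]_J) (gamma : T -> R) (p : T -> 'cV[R]_J)
    (eps : R) (nu : nat) (s : 'I_nu -> T)
    (x : 'cV[R]_J) (y lam : 'I_nu -> 'cV[R]_J) : Prop :=
  perp x (diag_mx c *m x - nu%:R^-1 *: (\sum_(l < nu) lam l) + a) /\
  forall l, second_stage (gamma (s l)) (p (s l)) eps x (y l) (lam l).

Definition saa_unique_solution_x (R : realType) (J : nat) (T : Type)
    (c : 'rV[R]_J) (a : 'cV[R]_J) (gamma : T -> R) (p : T -> 'cV[R]_J)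
    (eps : R) (nu : nat) (s : 'I_nu -> T) (x : 'cV[R]_J) : Prop :=
  exists y lam : 'I_nu -> 'cV[R]_J,
    saa_solution c a gamma p eps s x y lam /\
    forall x' y' lam', saa_solution c a gamma p eps s x' y' lam' ->
      [/\ x' = x, y' = y & lam' = lam].

(* Functions on Xi are represented by total functions on R^d, of which only the
   restriction to Xi is used. *)
Definition two_stage_solution (R : realType) (d J : nat)
    (P : probability (borel_rV R d) R) (Xi : set (borel_rV R d))
    (c : 'rV[R]_J) (a : 'cV[R]_J)
    (gamma : borel_rV R d -> R) (p : borel_rV R d -> 'cV[R]_J)
    (x : 'cV[R]_J) (y lam : borel_rV R d -> 'cV[R]_J) : Prop :=
  [/\ (forall j, measurable_fun Xi (fun xi => y xi j 0)) /\
      (exists M : R,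
         {ae P, forall xi, Xi xi -> forall j, `|y xi j 0| <= M}),
      forall j, P.-integrable Xi (fun xi => (lam xi j 0)%:E),
      perp x (diag_mx c *m x
              - (\col_j (\int[P]_(xi in Xi) lam xi j 0)) + a) &
      {ae P, forall xi, Xi xi ->
         second_stage (gamma xi) (p xi) 0 x (y xi) (lam xi)}].

Definition first_stage_solutions (R : realType) (d J : nat)
    (P : probability (borel_rV R d) R) (Xi : set (borel_rV R d))
    (c : 'rV[R]_J) (a : 'cV[R]_J)
    (gamma : borel_rV R d -> R) (p : borel_rV R d -> 'cV[R]_J) :
    set 'cV[R]_J :=
  [set x | exists y lam, two_stage_solution P Xi c a gamma p x y lam].

(* Outer limit as eps decreases to 0 of a one-parameter family of points: the
   set of its accumulation points. *)
Definition outer_limit_right0 (R : realType) (T : topologicalType)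
    (f : R -> T) : set T :=
  cluster (f eps @[eps --> 0^'+]).

(* Main.v *)
Require Import Defs.
From HB Require Import structures.
From mathcomp Require Import all_boot all_order all_algebra.
From mathcomp Require Import all_classical all_reals all_analysis.
From mathcomp Require Import finmap measurable_realfun zify ring lra.
Import Order.TTheory GRing.Theory Num.Theory.
Import numFieldNormedType.Exports.
Local Open Scope classical_set_scope.
Local Open Scope ring_scope.

(** Fix a realization (g, q) of (gamma, p) and a first-stage vector x >= 0.
The components of the second stage interact only through the total s of the
y_j: for given s, each pair (y_i, lam_i) solves a one-dimensional problem with
a closed form ([best_response]), and s is the root of an increasing scalar
equation. The formulas make sense for every eps >= 0. At eps = 0 the
multiplier is not unique in the components with x_i = 0; the formula
lam_i = max 0 (q_i - g s - g y_i) selects one, with 0 <= lam_i <= p0, and this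
selection is the limit of the regularized multipliers.

Subtracting two second-stage problems gives the inequality
[second_stage_monotone], from which everything quantitative follows: for
eps > 0 the solution is unique, and lam is antitone in x in the sense of
monotone operators and Lipschitz in (x, eps), with constants that do not depend
on the realization. These properties survive averaging, over a finite
sample as well as over the law P ([averaging]). Therefore the reduced
first-stage map x |-> C x - mean lam + a is strongly monotone and Lipschitz;
the complementarity problem it defines has exactly one solution
([exists_first_stage], [first_stage_unique]), and by strong monotonicity the
solutions of two such problems differ by at most a constant times the
difference of the two averages at one of the two solutions
([first_stage_stability]).

Let x*_eps be the solution for the law P. For fixed eps, x^eps_nu tends to
x*_eps as soon as the sample averages of lam at the single point x*_eps
converge, which is a strong law for bounded variables ([strong_law_bounded]).
It is invoked for rational eps only, a countable family of events; the
Lipschitz dependence on eps and the stability bound carry the convergence to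
all eps > 0 on the same event ([first_stage_cvg]).

What remains is deterministic. If x*_eps tends to x along eps_n -> 0, then
[second_stage_monotone], comparing eps_n with 0, bounds g |y_n - y|^2 by p0 times a
quantity that tends to 0; hence y_n and lam_n converge for each realization
([cvg_lamsol]), their means converge by dominated convergence, and the
first-stage complementarity conditions pass to the limit. *)

(** * Monotonicity of the second-stage problem *)

Section second_stage.
Context {R : realType} {J : nat}.
Implicit Types (g eps s : R) (q x y lam : 'cV[R]_J).

Lemma perpP (n : nat) (u v : 'cV[R]_n) :
  perp u v <-> forall i, [/\ 0 <= u i 0, 0 <= v i 0 & u i 0 * v i 0 = 0].
Proof.
have E : (u^T *m v) 0 0 = \sum_i u i 0 * v i 0.
  by rewrite mxE; apply: eq_bigr => i _; rewrite mxE.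
split=> [[u0 v0 uv] i|H].
  split=> //; move/matrixP : uv => /(_ 0 0); rewrite E mxE => /eqP.
  rewrite psumr_eq0 => [/allP/(_ i)|k _]; last exact: mulr_ge0.
  by rewrite mem_index_enum => /(_ isT)/eqP.
split=> [i|i|]; [by case: (H i)|by case: (H i)|].
apply/matrixP => i j; rewrite !ord1 E mxE big1// => k _.
by case: (H k).
Qed.

(** Blockwise form of the second stage: multiplication by Pi couples the
components only through the total of the y_j. *)
Lemma second_stageP g q eps x y lam :
  second_stage g q eps x y lam <-> forall i,
    [/\ 0 <= y i 0, 0 <= lam i 0,
        0 <= g * \sum_j y j 0 + g * y i 0 + lam i 0 - q i 0,
        0 <= eps * lam i 0 - y i 0 + x i 0 &
        y i 0 * (g * \sum_j y j 0 + g * y i 0 + lam i 0 - q i 0) = 0 /\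
        lam i 0 * (eps * lam i 0 - y i 0 + x i 0) = 0].
Proof.
rewrite /second_stage perpP mul_block_col add_col_mx.
have Eu i : (Pi_mx J g *m y + 1%:M *m lam + - q) i 0 =
    g * \sum_j y j 0 + g * y i 0 + lam i 0 - q i 0.
  rewrite mul1mx /Pi_mx -scalemxAl mulmxDl mul1mx -mulmxA !mxE; congr (_ + _ + _).
  rewrite mulrDr; congr (_ * _ + _).
  rewrite big_ord1 !mxE mul1r; apply: eq_bigr => j _.
  by rewrite !mxE mul1r.
have Ed i : (- 1%:M *m y + eps%:M *m lam + x) i 0 =
    eps * lam i 0 - y i 0 + x i 0.
  by rewrite mulNmx mul1mx mul_scalar_mx !mxE; ring.
split=> H i.
  have := H (lshift J i); have := H (rshift J i).
  rewrite !col_mxEd !col_mxEu Eu Ed => -[? ? ?] [? ? ?]; split=> //.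
case: (split_ordP i) => k ->; have [? ? ? ? []] := H k.
  by rewrite !col_mxEu Eu.
by rewrite !col_mxEd Ed.
Qed.

(** Complementarity makes (u - u') (w - w') nonpositive for each pair of
complementary components; summing these products leaves the quadratic form of
Pi, the regularization and the coupling with x. The term g (sum y - sum y')^2
is nonnegative and is dropped. The two parameters eps and eps' may differ, and
either may be 0. *)
Lemma second_stage_monotone {g q eps eps' x x' y y' lam lam'} :
  0 <= g -> second_stage g q eps x y lam ->
  second_stage g q eps' x' y' lam' ->
  g * (\sum_i (y i 0 - y' i 0) ^+ 2) +
  \sum_i (lam i 0 - lam' i 0) *
         (eps * lam i 0 - eps' * lam' i 0 + (x i 0 - x' i 0)) <= 0.
Proof.
move=> g0 /second_stageP H /second_stageP H'.
set Y := \sum_j y j 0; set Y' := \sum_j y' j 0.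
(* The off-diagonal identity blocks cancel in the sum of the two products. *)
have -> : g * (\sum_i (y i 0 - y' i 0) ^+ 2) +
  \sum_i (lam i 0 - lam' i 0) *
         (eps * lam i 0 - eps' * lam' i 0 + (x i 0 - x' i 0)) =
  \sum_i ((y i 0 - y' i 0) * ((g * Y + g * y i 0 + lam i 0 - q i 0) -
                              (g * Y' + g * y' i 0 + lam' i 0 - q i 0)) +
          (lam i 0 - lam' i 0) * ((eps * lam i 0 - y i 0 + x i 0) -
                                  (eps' * lam' i 0 - y' i 0 + x' i 0)))
  - g * (Y - Y') ^+ 2.
  have -> : g * (Y - Y') ^+ 2 = \sum_i (y i 0 - y' i 0) * (g * (Y - Y')).
    by rewrite -mulr_suml sumrB -/Y -/Y'; ring.
  rewrite mulr_sumr -big_split -sumrB /=; apply: eq_bigr => i _; ring.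
rewrite subr_le0; apply: (@le_trans _ _ 0); last by rewrite mulr_ge0 ?sqr_ge0.
apply: sumr_le0 => i _.
have [y0 l0 u0 v0 [yu lv]] := H i; have [y0' l0' u0' v0' [yu' lv']] := H' i.
rewrite -/Y -/Y' in u0 yu u0' yu'.
by nra.
Qed.

(** As the derivative in x of a convex second-stage value function, -lam is a
monotone map. *)
Lemma lam_monotone {g q eps x x' y y' lam lam'} : 0 <= g -> 0 <= eps ->
  second_stage g q eps x y lam -> second_stage g q eps x' y' lam' ->
  \sum_i (lam i 0 - lam' i 0) * (x i 0 - x' i 0) <= 0.
Proof.
move=> g0 e0 H H'; apply: le_trans (second_stage_monotone g0 H H').
rewrite -[leLHS]add0r lerD//.
  by rewrite mulr_ge0// sumr_ge0// => i _; rewrite sqr_ge0.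
apply: ler_sum => i _; rewrite -mulrBr.
have := sqr_ge0 (lam i 0 - lam' i 0) => ?; nra.
Qed.

(** Complete the square in [second_stage_monotone]: if d is the increment of
lam and b that of the data, then d (eps d + b) <= 0 in total gives
(eps d)^2 <= b^2 in total, because (eps d + b)^2 >= 0. *)
Lemma lam_lipschitz {g q eps eps' x x' y y' lam lam'} : 0 <= g -> 0 < eps ->
  second_stage g q eps x y lam -> second_stage g q eps' x' y' lam' ->
  eps ^+ 2 * (\sum_i (lam i 0 - lam' i 0) ^+ 2) <=
  \sum_i (x i 0 - x' i 0 + (eps - eps') * lam' i 0) ^+ 2.
Proof.
move=> g0 e0 H H'; have := second_stage_monotone g0 H H'.
set Q := g * _; have Q0 : 0 <= Q.
  by rewrite mulr_ge0// sumr_ge0// => i _; rewrite sqr_ge0.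
set S := \sum_i _ => QS; have {QS}S0 : S <= 0 by lra.
rewrite -subr_ge0 mulr_sumr -sumrB.
rewrite -(@pmulr_rge0 _ 1)// mul1r.
apply: (@le_trans _ _ (- (2 * eps) * S)); first by nra.
rewrite /S mulr_sumr; apply: ler_sum => i _.
set d := lam i 0 - lam' i 0; set e := x i 0 - x' i 0.
have -> : eps * lam i 0 - eps' * lam' i 0 + e = eps * d + (e + (eps - eps') * lam' i 0).
  by rewrite /d; ring.
set b := e + _; have := sqr_ge0 (eps * d + b) => ?; nra.
Qed.

Lemma second_stage_unique {g q eps x y y' lam lam'} : 0 < g -> 0 < eps ->
  second_stage g q eps x y lam -> second_stage g q eps x y' lam' ->
  y = y' /\ lam = lam'.
Proof.
move=> g0 e0 H H'.
have sq (u u' : 'cV[R]_J) : \sum_i (u i 0 - u' i 0) ^+ 2 <= 0 -> u = u'.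
  move=> le0; apply/colP => i; apply/eqP; rewrite -subr_eq0 -sqrf_eq0.
  have : \sum_i (u i 0 - u' i 0) ^+ 2 == 0.
    by rewrite eq_le le0 sumr_ge0// => k _; rewrite sqr_ge0.
  rewrite psumr_eq0 => [/allP/(_ i)|k _]; last exact: sqr_ge0.
  by rewrite mem_index_enum => /(_ isT).
have E : lam = lam'.
  apply: sq; rewrite -(pmulr_rle0 _ (exprn_gt0 2 e0)).
  apply: le_trans (lam_lipschitz (ltW g0) e0 H H') _.
  by rewrite big1// => i _; rewrite !subrr mul0r addr0 expr0n.
split=> //; apply: sq; rewrite -(pmulr_rle0 _ g0).
apply: le_trans (second_stage_monotone (ltW g0) H H').
by rewrite lerDl E sumr_ge0// => i _; rewrite subrr mul0r.
Qed.

End second_stage.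

Lemma cvg_sumr {R : realType} {J : nat} {T : Type} {F : set_system T}
    {FF : Filter F} (f : 'I_J -> T -> R) (l : 'I_J -> R) :
  (forall i, f i t @[t --> F] --> l i) ->
  \sum_i f i t @[t --> F] --> \sum_i l i.
Proof. by move=> fl; apply: cvg_big => //; exact: add_continuous. Qed.

(** * Explicit solution of the second stage *)

Section explicit_solution.
Context {R : realType} {J : nat}.
Implicit Types (g eps s r xi : R) (q x : 'cV[R]_J).

(** For eps > 0 this is the y >= 0 solving g y + max 0 (y - xi) / eps = r, or 0
if there is none: the left-hand side is the maximum of two increasing affine
functions, so its inverse is the minimum of their inverses. Clearing eps from
the denominators keeps the formula meaningful at eps = 0, where it is the
projection of r / g onto [0, xi]. *)
Definition best_response g eps xi r : R :=
  Num.max 0 (Num.min (r / g) ((eps * r + xi) / (eps * g + 1))).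

Lemma best_response_ge0 g eps xi r : 0 <= best_response g eps xi r.
Proof. by rewrite le_max lexx. Qed.

Lemma best_response_le {g eps xi r r'} : 0 < g -> 0 <= eps -> r <= r' ->
  best_response g eps xi r <= best_response g eps xi r'.
Proof.
move=> g0 e0 rr'; have d0 : 0 < eps * g + 1 by rewrite ltr_wpDl// mulr_ge0// ltW.
rewrite ge_max best_response_ge0/= le_max; apply/orP; right.
rewrite le_min !ge_min ler_pM2r ?invr_gt0// rr'/=.
by rewrite ler_pM2r ?invr_gt0// lerD2r ler_wpM2l// orbT.
Qed.

Lemma continuous_best_response g eps xi : continuous (best_response g eps xi).
Proof.
have affine a b : continuous (fun r : R => a * r + b).
  by move=> r; apply: cvgD; [apply: cvgMl_tmp; exact: cvg_id|exact: cvg_cst].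
have affine_div a b c : continuous (fun r : R => (a * r + b) / c).
  by move=> r; apply: cvgMr_tmp; exact: affine.
apply: (@max_fun_continuous _ R R (cst 0)); first by move=> r; exact: cvg_cst.
apply: (@min_fun_continuous _ R R (fun r => r / g)) => //.
by move=> r; apply: cvgMr_tmp; exact: cvg_id.
Qed.

(** If r <= g y then l = 0, and either y = 0 or y = r / g is below the kink xi.
If g y < r then y lies on the second branch, which says eps l - y + xi = 0. *)
Lemma best_response_perp g eps xi r (y := best_response g eps xi r)
    (l := Num.max 0 (r - g * y)) : 0 < g -> 0 <= eps -> 0 <= xi ->
  [/\ 0 <= g * y + l - r, 0 <= eps * l - y + xi,
      y * (g * y + l - r) = 0 & l * (eps * l - y + xi) = 0].
Proof.
move=> g0 e0 x0; have d0 : 0 < eps * g + 1 by rewrite ltr_wpDl// mulr_ge0// ltW.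
have y0 : 0 <= y by exact: best_response_ge0.
pose A := r / g; pose B := (eps * r + xi) / (eps * g + 1).
have Ag : A * g = r by rewrite divfK// gt_eqF.
have Bd : B * (eps * g + 1) = eps * r + xi by rewrite divfK// gt_eqF.
have gd : 0 <= g * y by rewrite mulr_ge0// ltW.
have [yr|ry] := leP (r - g * y) 0.
  have l0 : l = 0 by apply/max_idPl.
  have yE : y * (g * y - r) = 0 /\ y <= xi.
    have [m0|m0] := leP 0 (Num.min A B); last first.
      by have -> : y = 0; [exact/max_idPl/ltW|rewrite mul0r].
    have yE : y = Num.min A B by exact/max_idPr.
    have yA : y = A.
      apply/eqP; rewrite eq_le yE ge_min lexx/= -yE -(ler_pM2r g0) /= Ag.
      by rewrite mulrC -subr_le0.
    split; first by rewrite yA [g * A]mulrC Ag subrr mulr0.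
    have yB : y * (eps * g + 1) <= eps * r + xi.
      by rewrite -Bd ler_pM2r// yE ge_min lexx orbT.
    by rewrite -Ag -yA in yB; lra.
  by case: yE => yE yx; rewrite l0 !mul0r addr0 yE; split=> //; lra.
have lE : l = r - g * y by apply/max_idPr/ltW.
have yB : eps * r + xi <= y * (eps * g + 1).
  have : Num.min A B <= y by rewrite le_max lexx orbT.
  rewrite ge_min -Bd ler_pM2r// => /orP[|//].
  by move=> /(ler_wpM2r (ltW g0)); rewrite Ag => ?; exfalso; lra.
have By : y * (eps * g + 1) <= eps * r + xi.
  have [m0|m0] := leP 0 (Num.min A B).
    have -> : y = Num.min A B by exact/max_idPr.
    by rewrite -Bd ler_pM2r// ge_min lexx orbT.
  have -> : y = 0 by exact/max_idPl/ltW.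
  by rewrite mul0r addr_ge0// mulr_ge0//; lra.
have v0 : eps * l - y + xi = 0 by rewrite lE; lra.
by rewrite v0 mulr0 lE; split=> //; [lra|ring].
Qed.

Definition total_supply g eps q x : R :=
  xget 0 [set s | s = \sum_i best_response g eps (x i 0) (q i 0 - g * s)].

(** The defining equation has a root by the intermediate value theorem: the sum
of the responses is nonincreasing in s, so at s equal to its value M at 0 it
has dropped to at most M. *)
Lemma total_supplyE {g eps} q x : 0 < g -> 0 <= eps ->
  total_supply g eps q x =
  \sum_i best_response g eps (x i 0) (q i 0 - g * total_supply g eps q x).
Proof.
move=> g0 e0.
have [s hs] : exists s, s = \sum_i best_response g eps (x i 0) (q i 0 - g * s).
  pose h s := s - \sum_i best_response g eps (x i 0) (q i 0 - g * s).
  have sum_ge0 s : 0 <= \sum_i best_response g eps (x i 0) (q i 0 - g * s).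
    by apply: sumr_ge0 => i _; exact: best_response_ge0.
  pose M := \sum_i best_response g eps (x i 0) (q i 0 - g * 0).
  have M0 : 0 <= M by exact: sum_ge0.
  have h0 : h 0 <= 0 by rewrite /h sub0r oppr_le0; exact: sum_ge0.
  have hM : 0 <= h M.
    rewrite subr_ge0; apply: ler_sum => i _; apply: best_response_le => //.
    by rewrite lerD2l lerN2 ler_wpM2l// ltW.
  have ch : continuous h.
    move=> s; apply: cvgB; first exact: cvg_id.
    apply: cvg_sumr => i.
    apply: (@continuous_comp _ _ _ (fun s => q i 0 - g * s) (best_response g eps (x i 0))).
      apply: cvgB; first exact: cvg_cst.
      by apply: cvgMl_tmp; exact: cvg_id.
    exact: continuous_best_response.
  have [||s _ hs] := @IVT R h 0 M 0 M0.
  - exact: continuous_subspaceT.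
  - by rewrite ge_min h0/= le_max hM orbT.
  by exists s; apply/eqP; rewrite -subr_eq0; apply/eqP.
have := @xgetPex _ 0 [set s | s = \sum_i best_response g eps (x i 0) (q i 0 - g * s)].
by apply; exists s.
Qed.

(** Since s minus the sum of the responses is strictly increasing in s, its sign
at t locates the root. This replaces the implicitly defined root by an explicit
condition, which is what measurability needs. *)
Lemma total_supply_le {g eps} q x t : 0 < g -> 0 <= eps ->
  (total_supply g eps q x <= t) =
  (\sum_i best_response g eps (x i 0) (q i 0 - g * t) <= t).
Proof.
move=> g0 e0; apply/idP/idP => [st|].
  apply: le_trans (st); rewrite [leRHS]total_supplyE//; apply: ler_sum => i _.
  by apply: best_response_le => //; rewrite lerD2l lerN2 ler_wpM2l// ltW.
apply: contraTT; rewrite -!ltNge => ts; apply: (lt_le_trans ts).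
rewrite [leLHS]total_supplyE//; apply: ler_sum => i _.
by apply: best_response_le => //; rewrite lerD2l lerN2 ler_wpM2l ?ltW.
Qed.

Lemma total_supply_ge0 {g eps} q x : 0 < g -> 0 <= eps -> 0 <= total_supply g eps q x.
Proof.
by move=> g0 e0; rewrite total_supplyE// sumr_ge0// => i _; exact: best_response_ge0.
Qed.

Definition ysol g eps q x : 'cV[R]_J :=
  \col_i best_response g eps (x i 0) (q i 0 - g * total_supply g eps q x).

Definition lamsol g eps q x : 'cV[R]_J :=
  \col_i Num.max 0 (q i 0 - g * total_supply g eps q x - g * ysol g eps q x i 0).

Lemma sum_ysol {g eps} q x : 0 < g -> 0 <= eps ->
  \sum_i ysol g eps q x i 0 = total_supply g eps q x.
Proof.
by move=> g0 e0; rewrite [RHS]total_supplyE//; apply: eq_bigr => i _; rewrite mxE.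
Qed.

Lemma second_stage_sol {g eps} q x : 0 < g -> 0 <= eps ->
  (forall i, 0 <= x i 0) ->
  second_stage g q eps x (ysol g eps q x) (lamsol g eps q x).
Proof.
move=> g0 e0 x0; apply/second_stageP => i; rewrite sum_ysol//.
have := @best_response_perp g eps (x i 0) (q i 0 - g * total_supply g eps q x) g0 e0 (x0 i).
rewrite /= => -[]; rewrite [lamsol _ _ _ _ _ _]mxE.
have -> : ysol g eps q x i 0 = best_response g eps (x i 0) (q i 0 - g * total_supply g eps q x).
  by rewrite mxE.
set y := best_response _ _ _ _; set l := Num.max _ _.
have -> : g * y + l - (q i 0 - g * total_supply g eps q x) =
          g * total_supply g eps q x + g * y + l - q i 0 by ring.
move=> H1 H2 H3 H4; split=> //; first exact: best_response_ge0.
by rewrite le_max lexx.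
Qed.

Lemma ysol_ge0 g eps q x i : 0 <= ysol g eps q x i 0.
Proof. by rewrite mxE best_response_ge0. Qed.

Lemma lamsol_ge0 g eps q x i : 0 <= lamsol g eps q x i 0.
Proof. by rewrite mxE le_max lexx. Qed.

Lemma lamsol_le {g eps q x p0} i : 0 < g -> 0 <= eps -> 0 <= p0 ->
  q i 0 <= p0 -> lamsol g eps q x i 0 <= p0.
Proof.
move=> g0 e0 p00 qp; rewrite mxE ge_max p00/=.
have := total_supply_ge0 q x g0 e0; have := ysol_ge0 g eps q x i.
move: (ysol _ _ _ _ _ _) (total_supply _ _ _ _) => y s y0 s0.
have : 0 <= g * s by rewrite mulr_ge0// ltW.
have : 0 <= g * y by rewrite mulr_ge0// ltW.
by lra.
Qed.

Lemma ysol_le {g eps q x p0} i : 0 < g -> 0 <= eps -> 0 <= p0 ->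
  q i 0 <= p0 -> ysol g eps q x i 0 <= p0 / g.
Proof.
move=> g0 e0 p00 qp; rewrite mxE ge_max divr_ge0//= ?(ltW g0)//.
rewrite ge_min ler_pM2r ?invr_gt0//.
have : 0 <= g * total_supply g eps q x by rewrite mulr_ge0 ?total_supply_ge0// ltW.
by move=> ?; apply/orP; left; lra.
Qed.

End explicit_solution.

(** * Measurable dependence on the realization *)

Section measurability.
Context {R : realType} {J : nat} {d : measure_display} {T : measurableType d}.

Lemma measurable_fun_sublevel (f : T -> R) :
  (forall r, measurable_fun setT (fun t => f t <= r)) -> measurable_fun setT f.
Proof.
move=> mf; apply: (measurability (@RGenOInfty.G R)) => [|/= _ [_ [r ->] <-]].
  exact: RGenOInfty.measurableE.
have := mf r measurableT [set false] I; congr (measurable (_ `&` _)).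
by apply/seteqP; split=> t /=; rewrite in_itv/= andbT; case: leP.
Qed.

Lemma measurable_funV (f : T -> R) : (forall t, 0 < f t) ->
  measurable_fun setT f -> measurable_fun setT (fun t => (f t)^-1).
Proof.
move=> f0 mf; apply: measurable_fun_sublevel => r.
rewrite (_ : (fun t => _) = (fun t => 1 <= r * f t)).
  by apply: measurable_fun_ler => //; exact: measurable_funM.
by apply/funext => t; rewrite -[in LHS]div1r ler_pdivrMr.
Qed.

Lemma measurable_best_response (g r : T -> R) eps xi :
  (forall t, 0 < g t) -> 0 <= eps ->
  measurable_fun setT g -> measurable_fun setT r ->
  measurable_fun setT (fun t => best_response (g t) eps xi (r t)).
Proof.
move=> g0 e0 mg mr; apply: measurable_maxr; first exact: measurable_cst.
apply: measurable_minr.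
  by apply: measurable_funM => //; exact: measurable_funV.
apply: measurable_funM.
  by apply: measurable_funD => //; exact: measurable_funM.
apply: measurable_funV => [t|].
  by rewrite ltr_wpDl// mulr_ge0// ltW.
by apply: measurable_funD => //; exact: measurable_funM.
Qed.

Variables (g : T -> R) (q : T -> 'cV[R]_J).
Hypotheses (mg : measurable_fun setT g) (g0 : forall t, 0 < g t).
Hypothesis mq : forall i, measurable_fun setT (fun t => q t i 0).

Lemma measurable_total_supply eps x : 0 <= eps ->
  measurable_fun setT (fun t => total_supply (g t) eps (q t) x).
Proof.
move=> e0; apply: measurable_fun_sublevel => r.
under eq_fun do rewrite total_supply_le//.
apply: measurable_fun_ler => //; apply: measurable_sum => i.
apply: measurable_best_response => //.
by apply: measurable_funB => //; exact: measurable_funM.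
Qed.

Lemma measurable_ysol eps x i : 0 <= eps ->
  measurable_fun setT (fun t => ysol (g t) eps (q t) x i 0).
Proof.
move=> e0; under eq_fun do rewrite mxE.
apply: measurable_best_response => //.
apply: measurable_funB => //; apply: measurable_funM => //.
exact: measurable_total_supply.
Qed.

Lemma measurable_lamsol eps x i : 0 <= eps ->
  measurable_fun setT (fun t => lamsol (g t) eps (q t) x i 0).
Proof.
move=> e0; under eq_fun do rewrite mxE.
apply: measurable_maxr; first exact: measurable_cst.
apply: measurable_funB; last by apply: measurable_funM => //; exact: measurable_ysol.
apply: measurable_funB => //; apply: measurable_funM => //.
exact: measurable_total_supply.
Qed.

End measurability.

(** * Strongly monotone first-stage complementarity problems *)

Section first_stage.
Context {R : realType} {J : nat}.
Implicit Types (c : 'rV[R]_J) (a x : 'cV[R]_J) (L : 'cV[R]_J -> 'cV[R]_J).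

(** The first stage once the second-stage multipliers have been eliminated:
[L x] stands for their mean as a function of x. *)
Definition first_stage c a L x : Prop :=
  perp x (diag_mx c *m x - L x + a).

Lemma first_stageP c a L x : first_stage c a L x <-> forall i,
  [/\ 0 <= x i 0, 0 <= c 0 i * x i 0 - L x i 0 + a i 0 &
      x i 0 * (c 0 i * x i 0 - L x i 0 + a i 0) = 0].
Proof.
rewrite /first_stage perpP.
have E i : (diag_mx c *m x - L x + a) i 0 = c 0 i * x i 0 - L x i 0 + a i 0.
  by rewrite mul_diag_mx !mxE.
by split=> H i; have := H i; rewrite E.
Qed.

Lemma first_stage_ge0 {c a L x} : first_stage c a L x -> forall i, 0 <= x i 0.
Proof. by move=> /first_stageP H i; case: (H i). Qed.

Lemma exists_pos_lower_bound {c} : (forall i, 0 < c 0 i) ->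
  exists2 c0 : R, 0 < c0 & forall i, c0 <= c 0 i.
Proof.
move=> cpos; have S0 : 0 <= \sum_i (c 0 i)^-1.
  by apply: sumr_ge0 => i _; rewrite invr_ge0 ltW.
exists (1 + \sum_i (c 0 i)^-1)^-1 => [|i].
  by rewrite invr_gt0 ltr_pwDl.
rewrite -[leRHS]invrK lef_pV2 ?posrE ?invr_gt0 ?ltr_pwDl//.
rewrite (bigD1 i)//= addrCA lerDl addr_ge0// sumr_ge0// => k _.
by rewrite invr_ge0 ltW.
Qed.

(** The strongly monotone map C x - L x + a is compared with itself at x and x',
and then with C x' - L' x' + a, so only the discrepancy of L and L' at the one
point x' enters. *)
Lemma first_stage_stability {c a L L' x x'} {c0 delta : R} :
  0 < c0 -> (forall i, c0 <= c 0 i) ->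
  \sum_i (L x i 0 - L x' i 0) * (x i 0 - x' i 0) <= 0 ->
  (forall i, `|L x' i 0 - L' x' i 0| <= delta) ->
  first_stage c a L x -> first_stage c a L' x' ->
  forall i, `|x i 0 - x' i 0| <= J%:R * delta / c0.
Proof.
move=> c00 cc0 Lmono Ldelta /first_stageP Hx /first_stageP Hx'.
have H : \sum_i (c0 ^+ 2 * (x i 0 - x' i 0) ^+ 2) <= \sum_(i < J) delta ^+ 2.
  rewrite -subr_le0 -sumrB.
  apply: le_trans (_ : (2 * c0) * (\sum_i (L x i 0 - L x' i 0) * (x i 0 - x' i 0)) <= 0).
    rewrite mulr_sumr; apply: ler_sum => i _.
    have [x0 F0 xF] := Hx i; have [x0' F0' xF'] := Hx' i.
    have := Ldelta i; move: (x i 0) (x' i 0) (L x i 0) (L x' i 0) (L' x' i 0)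
      (cc0 i) x0 F0 xF x0' F0' xF' => u u' l l1 l' ci u0 F0 uF u0' F0' uF' ld.
    have h1 : (u - u') * (c 0 i * (u - u') - (l - l1) - (l1 - l')) <= 0 by nra.
    have h2 : (l1 - l') ^+ 2 <= delta ^+ 2.
      by rewrite -(real_normK (num_real (l1 - l'))) lerXn2r// ?nnegrE// (le_trans _ ld).
    have h3 : c0 * (u - u') ^+ 2 <= c 0 i * (u - u') ^+ 2.
      by rewrite ler_wpM2r ?sqr_ge0.
    have h4 := sqr_ge0 (c0 * (u - u') - (l1 - l')).
    have h5 : (u - u') * (c0 * (u - u') - (l - l1) - (l1 - l')) <= 0 by nra.
    have : 2 * c0 * ((u - u') * (c0 * (u - u') - (l - l1) - (l1 - l'))) <= 0.
      by rewrite pmulr_rle0// mulr_gt0.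
    by move=> ?; lra.
  by rewrite pmulr_rle0// mulr_gt0.
move=> i; have d0 : 0 <= delta by apply: le_trans (Ldelta i).
rewrite ler_pdivlMr// -ler_sqr ?nnegrE ?mulr_ge0// ?(ltW c00)//.
rewrite exprMn real_normK ?num_real// mulrC.
apply: (@le_trans _ _ (\sum_(i < J) delta ^+ 2)).
  apply: le_trans H; rewrite (bigD1 i)//= lerDl sumr_ge0// => k _.
  by rewrite mulr_ge0 ?sqr_ge0.
rewrite sumr_const card_ord -[delta ^+ 2 *+ _]mulr_natl exprMn ler_wpM2r ?sqr_ge0//.
by rewrite -natrX ler_nat; case: (J) => // n; rewrite leq_pmull.
Qed.

(** Projection onto an interval does not increase distances. *)
Lemma sqr_clip_le (M s t : R) :
  (Num.max 0 (Num.min s M) - Num.max 0 (Num.min t M)) ^+ 2 <= (s - t) ^+ 2.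
Proof.
wlog st : s t / s <= t.
  move=> W; have [st|/ltW ts] := leP s t; first exact: W.
  by rewrite -sqrrN opprB -[leRHS]sqrrN opprB; exact: W.
rewrite -sqrrN opprB -[leRHS]sqrrN opprB lerXn2r// ?nnegrE ?subr_ge0//.
  rewrite ge_max le_max lexx/= le_max; apply/orP; right.
  by rewrite le_min !ge_min st lexx orbT.
have [h1|h1] := leP s M; have [h2|h2] := leP t M.
- by have [] := leP 0 s; have [] := leP 0 t; lra.
- by have [] := leP 0 s; have [] := leP 0 M; lra.
- by have [] := leP 0 M; have [] := leP 0 t; lra.
- by have [] := leP 0 M; lra.
Qed.

Section existence.
Variables (c : 'rV[R]_J) (a : 'cV[R]_J) (L : 'cV[R]_J -> 'cV[R]_J) (p0 K : R).
Hypotheses (cpos : forall i, 0 < c 0 i) (apos : forall i, 0 <= a i 0).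
Hypotheses (p0_ge0 : 0 <= p0) (K0 : 0 <= K).
Let nonneg x := forall i, 0 <= x i 0.
Hypothesis Lmono : forall x x', nonneg x -> nonneg x' ->
  \sum_i (L x i 0 - L x' i 0) * (x i 0 - x' i 0) <= 0.
Hypothesis Llip : forall x x', nonneg x -> nonneg x' ->
  \sum_i (L x i 0 - L x' i 0) ^+ 2 <= K * \sum_i (x i 0 - x' i 0) ^+ 2.
Hypothesis Lbnd : forall x, nonneg x -> forall i, L x i 0 <= p0.

Let F x i := c 0 i * x i 0 - L x i 0 + a i 0.

(** For a c0-strongly monotone F with squared Lipschitz constant L2, the step
x - tau F x contracts squared Euclidean distances by 1 - 2 tau c0 + tau^2 L2;
tau = c0 / L2 minimizes this factor. *)
Let contraction : exists tau k : R, [/\ 0 < tau, k < 1 &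
  forall x x', nonneg x -> nonneg x' ->
    \sum_i ((x i 0 - tau * F x i) - (x' i 0 - tau * F x' i)) ^+ 2 <=
    k * \sum_i (x i 0 - x' i 0) ^+ 2].
Proof.
have [c0 c00 cc0] := exists_pos_lower_bound cpos.
pose C := \sum_i c 0 i ^+ 2.
have cC i : c 0 i ^+ 2 <= C.
  by rewrite /C (bigD1 i)//= lerDl sumr_ge0// => k _; rewrite sqr_ge0.
pose L2 := 2 * C + 2 * K + 1.
have C0 : 0 <= C by rewrite sumr_ge0// => i _; rewrite sqr_ge0.
have L20 : 0 < L2.
  by rewrite ltr_wpDl// addr_ge0// mulr_ge0.
exists (c0 / L2), (1 - c0 ^+ 2 / L2); split.
- by rewrite divr_gt0.
- by rewrite ltrBlDr ltrDl divr_gt0// exprn_gt0.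
move=> x x' x0 x0'; set tau := c0 / L2; set S := \sum_i (x i 0 - x' i 0) ^+ 2.
have tau0 : 0 <= tau by rewrite divr_ge0// ltW.
have HF : \sum_i (F x i - F x' i) ^+ 2 <= L2 * S.
  apply: (@le_trans _ _ (\sum_i (2 * (C * (x i 0 - x' i 0) ^+ 2) +
                                 2 * (L x i 0 - L x' i 0) ^+ 2))).
    apply: ler_sum => i _; rewrite /F.
    have := cC i; move: (x i 0) (x' i 0) (L x i 0) (L x' i 0) (c 0 i) (a i 0).
    move=> u u' l l' ci ai ciC.
    have h : ci ^+ 2 * (u - u') ^+ 2 <= C * (u - u') ^+ 2.
      by rewrite ler_wpM2r ?sqr_ge0.
    have := sqr_ge0 (ci * (u - u') + (l - l')); lra.
  rewrite big_split/= -!mulr_sumr -/S.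
  have := Llip _ _ x0 x0'; rewrite -/S => ?.
  have : 0 <= S by rewrite sumr_ge0// => i _; rewrite sqr_ge0.
  by rewrite /L2; lra.
have HM : c0 * S <= \sum_i (F x i - F x' i) * (x i 0 - x' i 0).
  rewrite -subr_ge0 /S mulr_sumr -sumrB.
  apply: (@le_trans _ _ (- \sum_i (L x i 0 - L x' i 0) * (x i 0 - x' i 0))).
    by rewrite oppr_ge0; exact: Lmono.
  rewrite -sumrN; apply: ler_sum => i _; rewrite /F.
  have h : c0 * (x i 0 - x' i 0) ^+ 2 <= c 0 i * (x i 0 - x' i 0) ^+ 2.
    by rewrite ler_wpM2r ?sqr_ge0.
  lra.
have -> : \sum_i (x i 0 - tau * F x i - (x' i 0 - tau * F x' i)) ^+ 2 =
  S - 2 * tau * (\sum_i (F x i - F x' i) * (x i 0 - x' i 0)) +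
  tau ^+ 2 * \sum_i (F x i - F x' i) ^+ 2.
  rewrite /S !mulr_sumr -sumrB -big_split/=; apply: eq_bigr => i _; ring.
have h1 : tau ^+ 2 * \sum_i (F x i - F x' i) ^+ 2 <= tau ^+ 2 * (L2 * S).
  by rewrite ler_wpM2l ?sqr_ge0.
have h2 : tau * (c0 * S) <= tau * \sum_i (F x i - F x' i) * (x i 0 - x' i 0).
  by rewrite ler_wpM2l.
have E1 : tau ^+ 2 * (L2 * S) = tau * (c0 * S).
  by rewrite /tau; field; rewrite gt_eqF.
have -> : (1 - c0 ^+ 2 / L2) * S = S - tau * (c0 * S) by rewrite /tau; ring.
by lra.
Qed.

(** Project the step x - tau F x onto the box [0, M]^J. This map is a contraction
of the Euclidean distance, so a minimizer of the displacement |v - T v|^2 on the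
compact box is a fixed point: otherwise T v would have a smaller displacement.
M is so large that F_i > 0 on the face x_i = M, hence a fixed point never
touches that face and solves the complementarity problem. *)
Lemma exists_first_stage : exists x, first_stage c a L x.
Proof.
have [tau [k [tau0 k1 Hk]]] := contraction.
have [c0 c00 cc0] := exists_pos_lower_bound cpos.
pose M := (p0 + 1) / c0.
have M0 : 0 <= M by rewrite divr_ge0 ?addr_ge0// ltW.
(* L is controlled on the nonnegative orthant only; composing with the
   projection onto it makes the displacement continuous everywhere. *)
pose pos (v : 'rV[R]_J) : 'cV[R]_J := \col_i Num.max 0 (v 0 i).
have pos_ge0 v : nonneg (pos v) by move=> i; rewrite mxE le_max lexx.
pose T x i : R := Num.max 0 (Num.min (x i 0 - tau * F x i) M).
have T0 x i : 0 <= T x i by rewrite le_max lexx.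
have TM x i : T x i <= M by rewrite ge_max M0 ge_min lexx orbT.
pose psi (v : 'rV[R]_J) := \sum_i (v 0 i - T (pos v) i) ^+ 2.
pose A := [set v : 'rV[R]_J | forall i, `[0, M]%classic (v ord0 i)].
have cA : compact A by apply: (@rV_compact _ _ (fun=> `[0, M]%classic)) => i; exact: segment_compact.
have A0 : A !=set0 by exists 0 => i; rewrite /= mxE in_itv/= lexx.
have cpsi : continuous psi.
  have cpos_coord i : continuous (fun v => pos v i 0).
    under eq_fun do rewrite mxE.
    apply: (@max_fun_continuous _ _ R (cst 0) (fun v : 'rV[R]_J => v 0 i)).
      exact: cst_continuous.
    by move=> w; exact: coord_continuous.
  have cL i : continuous (fun v => L (pos v) i 0).
    move=> v; have FF := nbhs_filter v.
    apply/cvgrPdist_lt => e e0.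
    have : K * \sum_i (pos v i 0 - pos w i 0) ^+ 2 @[w --> v] -->
           K * \sum_i (pos v i 0 - pos v i 0) ^+ 2.
      apply: cvgMl_tmp; apply: cvg_sumr => j.
      have H : pos v j 0 - pos w j 0 @[w --> v] --> pos v j 0 - pos v j 0.
        by apply: cvgB; [exact: cvg_cst|exact: cpos_coord].
      by under eq_fun do rewrite expr2; rewrite expr2; exact: cvgM.
    rewrite big1 => [|j _]; last by rewrite subrr expr0n.
    rewrite mulr0 => /cvgr_lt/(_ (e ^+ 2) (exprn_gt0 2 e0)).
    apply: filterS => w Hw.
    rewrite -ltr_sqr ?nnegrE ?(ltW e0)// real_normK ?num_real//.
    apply: le_lt_trans Hw; apply: le_trans (Llip _ _ (pos_ge0 v) (pos_ge0 w)).
    by rewrite (bigD1 i)//= lerDl sumr_ge0// => j _; rewrite sqr_ge0.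
  have cT i : continuous (fun v => T (pos v) i).
    apply: (@max_fun_continuous _ _ R (cst 0)
      (fun v => Num.min (pos v i 0 - tau * F (pos v) i) M)).
      exact: cst_continuous.
    apply: (@min_fun_continuous _ _ R
      (fun v => pos v i 0 - tau * F (pos v) i) (cst M)); last first.
      exact: cst_continuous.
    have cF : continuous (fun v => F (pos v) i).
      move=> w; have FF := nbhs_filter w; apply: cvgD; last exact: cvg_cst.
      by apply: cvgB; [apply: cvgMl_tmp; exact: cpos_coord|exact: cL].
    move=> w; have FF := nbhs_filter w; apply: cvgB; first exact: cpos_coord.
    by apply: cvgMl_tmp; exact: cF.
  move=> w; have FF := nbhs_filter w; apply: cvg_sumr => i.
  have H : (v : 'rV[R]_J) 0 i - T (pos v) i @[v --> w] --> w 0 i - T (pos w) i.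
    by apply: cvgB; [exact: coord_continuous|exact: cT].
  by under eq_fun do rewrite expr2; rewrite expr2; exact: cvgM.
have [v Av vmin] := compact_EVT_min A0 cA (continuous_subspaceT cpsi).
have posA w : A w -> forall i, pos w i 0 = w 0 i.
  by move=> Aw i; rewrite mxE; apply/max_idPr; have := Aw i; rewrite /= in_itv/= => /andP[].
have {}Av := set_mem Av.
pose z : 'rV[R]_J := \row_i T (pos v) i.
have Az : A z by move=> i; rewrite /= mxE in_itv/= T0 TM.
have psi0 : psi v = 0.
  have le1 : psi v <= psi z by apply: vmin; exact/mem_set.
  have le2 : psi z <= k * psi v.
    have -> : psi v = \sum_i (pos v i 0 - pos z i 0) ^+ 2.
      by apply: eq_bigr => i _; rewrite !posA// [z _ _]mxE.
    apply: le_trans (Hk _ _ (pos_ge0 v) (pos_ge0 z)).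
    by apply: ler_sum => i _; rewrite {1}/z mxE; exact: sqr_clip_le.
  apply/eqP; rewrite eq_le; apply/andP; split; last first.
    by rewrite sumr_ge0// => i _; rewrite sqr_ge0.
  have : (1 - k) * psi v <= 0 by rewrite mulrBl mul1r subr_le0 (le_trans le1).
  by rewrite pmulr_rle0 ?subr_gt0.
have fix_v i : pos v i 0 = T (pos v) i.
  move/eqP : psi0; rewrite psumr_eq0 => [/allP/(_ i)|l _]; last exact: sqr_ge0.
  by rewrite mem_index_enum => /(_ isT); rewrite sqrf_eq0 subr_eq0 posA// => /eqP.
exists (pos v); apply/first_stageP => i; rewrite -/(F (pos v) i).
have x0 := pos_ge0 v i.
have F_ge0 : 0 <= F (pos v) i.
  rewrite leNgt; apply/negP => F0.
  have xM : pos v i 0 = M.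
    apply/eqP; rewrite eq_le {1}fix_v TM/= leNgt; apply/negP => xM.
    have : pos v i 0 < T (pos v) i; last by rewrite -fix_v ltxx.
    rewrite /T lt_max lt_min xM andbT ltrDl oppr_gt0 pmulr_rlt0// F0 orbT//.
  have := Lbnd _ (pos_ge0 v) i; have := apos i; move: F0; rewrite /F xM.
  have : c0 * M <= c 0 i * M by rewrite ler_wpM2r.
  have : c0 * M = p0 + 1 by rewrite mulrC divfK// gt_eqF.
  by lra.
split=> //; have [->|x_neq0] := eqVneq (pos v i 0) 0; first by rewrite mul0r.
have xpos : 0 < pos v i 0 by rewrite lt0r x_neq0.
suff : F (pos v) i <= 0.
  by move=> F_le0; rewrite (_ : F _ _ = 0) ?mulr0//; apply/eqP; rewrite eq_le F_le0.
rewrite leNgt; apply/negP => F0.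
have : T (pos v) i < pos v i 0; last by rewrite -fix_v ltxx.
by rewrite /T gt_max xpos gt_min ltrBlDr ltrDl mulr_gt0.
Qed.

End existence.
End first_stage.

(** * Means of bounded measurable functions *)

Section bounded_measurable.
Context {R : realType} {d : measure_display} {T : measurableType d}.
Implicit Types f h : T -> R.

Definition bounded_measurable f : Prop :=
  measurable_fun setT f /\ exists M : R, forall t, `|f t| <= M.

Lemma bounded_measurable_cst (k : R) : bounded_measurable (fun=> k).
Proof. by split=> //; exists `|k|. Qed.

Lemma bounded_measurableD {f h} : bounded_measurable f -> bounded_measurable h ->
  bounded_measurable (fun t => f t + h t).
Proof.
move=> [mf [M fM]] [mh [N hN]]; split; first exact: measurable_funD.
by exists (M + N) => t; rewrite (le_trans (ler_normD _ _))// lerD.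
Qed.

Lemma bounded_measurableM {f h} : bounded_measurable f -> bounded_measurable h ->
  bounded_measurable (fun t => f t * h t).
Proof.
move=> [mf [M fM]] [mh [N hN]]; split; first exact: measurable_funM.
by exists (M * N) => t; rewrite normrM ler_pM.
Qed.

Lemma bounded_measurableB {f h} :
  bounded_measurable f -> bounded_measurable h ->
  bounded_measurable (fun t => f t - h t).
Proof.
move=> bf [mh [N hN]]; apply: bounded_measurableD => //; split.
  exact/measurable_funN.
by exists N => t; rewrite normrN.
Qed.

Lemma bounded_measurable_sum {I : Type} (r : seq I) (f : I -> T -> R) :
  (forall i, bounded_measurable (f i)) ->
  bounded_measurable (fun t => \sum_(i <- r) f i t).
Proof.
move=> bf; elim: r => [|i r IH].
  by under eq_fun do rewrite big_nil; exact: bounded_measurable_cst.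
by under eq_fun do rewrite big_cons; exact: bounded_measurableD.
Qed.

Lemma bounded_measurable_comp {d'} {T' : measurableType d'} {f} (phi : T' -> T) :
  measurable_fun setT phi -> bounded_measurable f ->
  measurable_fun setT (f \o phi) /\ exists M : R, forall t, `|(f \o phi) t| <= M.
Proof.
move=> mphi [mf [M fM]]; split; first exact: measurableT_comp.
by exists M => t; exact: fM.
Qed.

Variable P : probability T R.

Lemma bounded_integrable {f} : bounded_measurable f ->
  P.-integrable setT (EFin \o f).
Proof.
move=> [mf [M fM]]; apply: measurable_bounded_integrable => //.
  by apply: le_lt_trans (probability_le1 P measurableT) _; exact: ltry.
by exists M; split; rewrite ?num_real// => x Mx t _; exact/(le_trans (fM t))/ltW.
Qed.

Lemma mean_cst (k : R) : \int[P]_t k = k.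
Proof.
rewrite Rintegral_cst// -[RHS]mulr1; congr (_ * _).
by rewrite -[RHS]/(fine (1%:E : \bar R)); congr fine; exact: probability_setT.
Qed.

Lemma meanD {f h} : bounded_measurable f -> bounded_measurable h ->
  \int[P]_t (f t + h t) = \int[P]_t f t + \int[P]_t h t.
Proof. by move=> bf bh; rewrite RintegralD//; exact: bounded_integrable. Qed.

Lemma meanZ (k : R) {f} : bounded_measurable f ->
  \int[P]_t (k * f t) = k * \int[P]_t f t.
Proof. by move=> bf; rewrite RintegralZl//; exact: bounded_integrable. Qed.

Lemma mean_le {f h} : bounded_measurable f -> bounded_measurable h ->
  (forall t, f t <= h t) -> \int[P]_t f t <= \int[P]_t h t.
Proof. by move=> bf bh fh; apply: le_Rintegral => //; exact: bounded_integrable. Qed.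

Lemma mean_sum {I : Type} (r : seq I) (f : I -> T -> R) :
  (forall i, bounded_measurable (f i)) ->
  \int[P]_t (\sum_(i <- r) f i t) = \sum_(i <- r) \int[P]_t f i t.
Proof.
move=> bf; elim: r => [|i r IH].
  by under eq_Rintegral do rewrite big_nil; rewrite mean_cst big_nil.
under eq_Rintegral do rewrite big_cons.
rewrite meanD ?big_cons ?IH//; exact: bounded_measurable_sum.
Qed.

Lemma mean_EFin {f} : bounded_measurable f ->
  (\int[P]_t (f t)%:E)%E = (\int[P]_t f t)%:E.
Proof.
by move=> bf; rewrite /Rintegral fineK//; apply: integrable_fin_num => //;
  exact: bounded_integrable.
Qed.

End bounded_measurable.

(** * Pairs of independent samples *)

Section iid_pairs.
Context {R : realType} {dO dT : measure_display}.
Context {Omega : measurableType dO} {T : measurableType dT}.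
Variables (Pr : probability Omega R) (P : probability T R).
Variable X : nat -> {RV Pr >-> T}.
Hypothesis iidX : iid_samples P X.

Lemma pair_independent (i j : nat) (A B : set T) : i != j ->
  measurable A -> measurable B ->
  Pr ((X i @^-1` A) `&` (X j @^-1` B)) = (P A * P B)%E.
Proof.
move=> ij mA mB.
have := iidX.1 [fset i; j]%fset (fun k => if k == i then A else B).
have -> : \bigcap_(k in [set` [fset i; j]%fset])
    X k @^-1` (if k == i then A else B) = (X i @^-1` A) `&` (X j @^-1` B).
  apply/seteqP; split=> [w H|w [HA HB] k /=].
    split; first by have := H i; rewrite /= eqxx; apply; rewrite !inE eqxx.
    by have := H j; rewrite /= eq_sym (negbTE ij); apply; rewrite !inE eqxx orbT.
  by rewrite !inE => /orP[|] /eqP->; rewrite ?eqxx// eq_sym (negbTE ij).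
move=> ->; last by move=> k; case: ifP.
rewrite (perm_big [:: i; j]) /=; last first.
  apply: uniq_perm; rewrite ?fset_uniq//= ?inE ?ij//.
  by move=> k; rewrite !inE.
rewrite !big_cons big_nil mule1 eqxx eq_sym (negbTE ij).
by rewrite -(iidX.2 i A mA) -(iidX.2 j B mB).
Qed.

(** The joint law of two distinct samples agrees with the product measure on
rectangles, hence everywhere, and the iterated integral factorizes. *)
Lemma uncorrelated (i j : nat) (f : T -> R) : i != j -> bounded_measurable f ->
  \int[Pr]_w (f (X i w) * f (X j w)) = (\int[P]_t f t) ^+ 2.
Proof.
move=> ij bf; have mf : measurable_fun setT f by case: bf.
pose phi w := (X i w, X j w).
have mphi : measurable_fun setT phi by exact: measurable_fun_pair.
pose h (z : T * T) := f z.1 * f z.2.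
have bh : bounded_measurable h.
  by apply: bounded_measurableM; apply: (bounded_measurable_comp _ _ bf).
have -> : \int[Pr]_w (f (X i w) * f (X j w)) = \int[(P \x P)%E]_z h z.
  rewrite /Rintegral; congr fine.
  rewrite -[LHS](@integral_pushforward _ _ _ _ _ phi _ Pr setT (EFin \o h))//=.
  - apply: eq_measure_integral => Z mZ _; apply/esym.
    apply: (@product_measure_unique _ _ _ _ _ P P (pushforward Pr phi)) => //.
    by move=> A B mA mB; rewrite -(pair_independent _ _ _ _ ij mA mB).
  - by apply/measurable_EFinP; case: bh.
  - by apply: bounded_integrable; exact: bounded_measurable_comp.
rewrite /Rintegral -integral12_prod_meas1/=; last exact: bounded_integrable.
rewrite /fubini_F /h/=.
under eq_integral => x _.
  rewrite (_ : (\int[P]_y (f x * f y)%:E)%E = (f x * \int[P]_t f t)%:E).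
    over.
  rewrite mean_EFin ?meanZ//.
  by apply: bounded_measurableM => //; exact: bounded_measurable_cst.
have -> : (\int[P]_x (f x * \int[P]_t f t)%:E)%E = (\int[P]_t f t * \int[P]_t f t)%:E.
  rewrite mean_EFin; last first.
    by apply: bounded_measurableM => //; exact: bounded_measurable_cst.
  by under eq_Rintegral do rewrite mulrC; rewrite meanZ.
by rewrite /= expr2.
Qed.

End iid_pairs.

(** * Strong law of large numbers for bounded functions *)

Lemma sum_inv_sqr_le {R : realType} n : \sum_(k < n) (k.+1%:R ^+ 2)^-1 <= 2 :> R.
Proof.
case: n => [|n]; first by rewrite big_ord0.
(* A bound that telescopes: 1/x - 1/(x+1) exceeds 1/(x+1)^2. *)
suff : \sum_(k < n.+1) (k.+1%:R ^+ 2)^-1 <= 2 - n.+1%:R^-1 :> R.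
  by move=> /le_trans; apply; rewrite gerBl invr_ge0.
elim: n => [|n IH]; first by rewrite big_ord1 expr1n invr1; lra.
rewrite big_ord_recr/=; apply: le_trans (lerD IH (lexx _)) _.
have n0 : 0 < n.+1%:R :> R by rewrite ltr0n.
rewrite -(natr1 n.+1); set x : R := n.+1%:R in n0 *.
rewrite -subr_ge0 (_ : _ - _ = (x * (x + 1) ^+ 2)^-1); last first.
  by field; rewrite ?gt_eqF// addr_gt0.
by rewrite invr_ge0 mulr_ge0 ?sqr_ge0// ltW.
Qed.

Lemma between_squares n : exists k, (k ^ 2 <= n < k.+1 ^ 2)%N.
Proof.
elim: n => [|n [k kn]]; first by exists 0%N.
have [nk|nk] := ltnP n.+1 (k.+1 ^ 2); first by exists k; lia.
by exists k.+1; lia.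
Qed.

(** For bounded terms, the averages at squares control all averages: between
consecutive squares (k+1)^2 and (k+2)^2 the sum changes by at most
2 (k+1) B, which is negligible against (k+1)^2. *)
Lemma average_cvg_along_squares {R : realType} (z : nat -> R) (B : R) :
  (forall l, `|z l| <= B) ->
  ((k.+1 ^ 2)%:R^-1 * \sum_(l < k.+1 ^ 2) z l) ^+ 2 @[k --> \oo] --> (0 : R) ->
  n%:R^-1 * \sum_(l < n) z l @[n --> \oo] --> (0 : R).
Proof.
move=> zB s_cvg; apply/cvgrPdist_le => e e0.
have B0 : 0 <= B by apply: le_trans (zB 0%N).
have e2 : 0 < (e / 2) ^+ 2 by rewrite exprn_gt0// divr_gt0.
have [K1 _ HK1] := cvgr_lt _ s_cvg _ e2.
(* Beyond this index 2 (k+1) B <= (e / 2) (k+1)^2. *)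
pose K2 := Num.truncn (4 * B / e).
exists ((maxn K1 K2).+1 ^ 2)%N => // n /= Kn.
have [[|k] /andP[kn nk]] := between_squares n; first by lia.
have kK : (maxn K1 K2 <= k)%N.
  rewrite -ltnS; rewrite leqNgt; apply/negP => kK.
  by have : (k.+2 ^ 2 <= (maxn K1 K2).+1 ^ 2)%N; [rewrite leq_sqr; lia|lia].
have n0 : 0 < n%:R :> R by rewrite ltr0n; lia.
rewrite sub0r normrN normrM normfV (ger0_norm (ltW n0)) ler_pdivrMl//.
set m := (k.+1 ^ 2)%N in kn *.
have m0 : 0 < m%:R :> R by rewrite ltr0n /m; lia.
have Hm : `|\sum_(l < m) z l| <= m%:R * (e / 2).
  have /= := HK1 k; rewrite -/m => /(_ (leq_trans (leq_maxl _ _) kK)).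
  rewrite -(real_normK (num_real (_ * _))) ltr_sqr ?nnegrE ?divr_ge0 ?(ltW e0)//.
  by rewrite normrM normfV (ger0_norm (ltW m0)) ltr_pdivrMl// => /ltW.
have tail : `|\sum_(m <= l < n) z l| <= (n - m)%:R * B.
  apply: le_trans (ler_norm_sum _ _ _) _.
  apply: le_trans (_ : \sum_(m <= l < n) B <= _); first exact: ler_sum.
  by rewrite sumr_const_nat mulr_natl.
have kB : 4 * B <= e * k.+1%:R.
  rewrite [leRHS]mulrC -ler_pdivrMr//; apply/ltW.
  apply: lt_le_trans (truncnS_gt _) _.
  by rewrite ler_nat ltnS (leq_trans (leq_maxr _ _) kK).
have nm : (n - m)%:R <= 2 * k.+1%:R :> R by rewrite -natrM ler_nat /m; lia.
have mE : m%:R = k.+1%:R * k.+1%:R :> R by rewrite /m -natrM; congr _%:R; lia.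
have mn : m%:R <= n%:R :> R by rewrite ler_nat.
rewrite -(big_mkord xpredT) (big_cat_nat (leq0n m) kn)//= big_mkord.
apply: le_trans (ler_normD _ _) _; apply: le_trans (lerD Hm tail) _.
have h1 : (n - m)%:R * B <= 2 * k.+1%:R * B by rewrite ler_wpM2r.
have h2 : 4 * B * k.+1%:R <= e * k.+1%:R * k.+1%:R by rewrite ler_wpM2r.
have h3 : m%:R * e <= n%:R * e by rewrite ler_wpM2r// ltW.
rewrite mE in h3 *; lra.
Qed.

Section strong_law.
Context {R : realType} {dO dT : measure_display}.
Context {Omega : measurableType dO} {T : measurableType dT}.
Variables (Pr : probability Omega R) (P : probability T R).
Variable X : nat -> {RV Pr >-> T}.
Hypothesis iidX : iid_samples P X.

(** Distinct samples are uncorrelated, so the cross terms of the square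
vanish. *)
Lemma second_moment_sum (f : T -> R) (B : R) n : measurable_fun setT f ->
  (forall t, `|f t| <= B) -> \int[P]_t f t = 0 ->
  \int[Pr]_w (\sum_(l < n) f (X l w)) ^+ 2 <= n%:R * B ^+ 2.
Proof.
move=> mf fB f0; have bf : bounded_measurable f by split=> //; exists B.
have bfX l : bounded_measurable (fun w => f (X l w)).
  exact: bounded_measurable_comp.
have B0 : 0 <= B by apply: le_trans (fB point).
elim: n => [|n IH].
  under eq_Rintegral do rewrite big_ord0 expr0n.
  by rewrite mean_cst mul0r.
pose S w := \sum_(l < n) f (X l w).
have bS : bounded_measurable S by exact: bounded_measurable_sum.
have bSf : bounded_measurable (fun w => S w * f (X n w)).
  exact: bounded_measurableM.
have Sf0 : \int[Pr]_w (S w * f (X n w)) = 0.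
  under eq_Rintegral do rewrite /S mulr_suml.
  rewrite mean_sum => [|l]; last exact: bounded_measurableM.
  rewrite big1// => l _; rewrite (uncorrelated _ P _ iidX) ?f0 ?expr0n//.
  by rewrite ltn_eqF.
have -> : \int[Pr]_w (\sum_(l < n.+1) f (X l w)) ^+ 2 =
  \int[Pr]_w (S w * S w + (2 * (S w * f (X n w)) + f (X n w) * f (X n w))).
  by apply: eq_Rintegral => w _; rewrite big_ord_recr/= -/(S w); ring.
have b2Sf : bounded_measurable (fun w => 2 * (S w * f (X n w))).
  by apply: bounded_measurableM => //; exact: bounded_measurable_cst.
have bff : bounded_measurable (fun w => f (X n w) * f (X n w)).
  exact: bounded_measurableM.
rewrite meanD//; [|exact: bounded_measurableM|exact: bounded_measurableD].
rewrite meanD// meanZ// Sf0 mulr0 add0r -natr1 mulrDl mul1r lerD//.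
rewrite -(mean_cst Pr (B ^+ 2)); apply: mean_le => //.
  exact: bounded_measurable_cst.
move=> w; rewrite -expr2 -(real_normK (num_real (f _))).
by rewrite lerXn2r// nnegrE.
Qed.

(** After centering, the second moment of the average over n samples is O(1/n),
hence summable along n = k^2. The sum over k of the squared averages thus has
finite expectation, so it is almost surely finite and its terms tend to 0. *)
Lemma strong_law_bounded (h : T -> R) : bounded_measurable h ->
  {ae Pr, forall w,
    n%:R^-1 * \sum_(l < n) h (X l w) @[n --> \oo] --> \int[P]_t h t}.
Proof.
move=> bh; set m := \int[P]_t h t; pose f t := h t + - m.
have bf : bounded_measurable f.
  by apply: bounded_measurableD => //; exact: bounded_measurable_cst.
have f0 : \int[P]_t f t = 0.
  rewrite meanD//; last exact: bounded_measurable_cst.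
  by rewrite mean_cst subrr.
have [mf [B fB]] := bf.
pose s k w := (k.+1 ^ 2)%:R^-1 * \sum_(l < k.+1 ^ 2) f (X l w).
have bs k : bounded_measurable (s k).
  apply: bounded_measurableM; first exact: bounded_measurable_cst.
  by apply: bounded_measurable_sum => l; exact: bounded_measurable_comp.
pose u k w := s k w ^+ 2.
have bu k : bounded_measurable (u k) by exact: bounded_measurableM.
have u0 k w : 0 <= u k w by exact: sqr_ge0.
have mu k : measurable_fun setT (EFin \o u k).
  by apply/measurable_EFinP; case: (bu k).
have uE k : \int[Pr]_w u k w <= B ^+ 2 * (k.+1%:R ^+ 2)^-1.
  rewrite /u /s; under eq_Rintegral do rewrite exprMn.
  rewrite meanZ; last first.
    apply: bounded_measurableM; apply: bounded_measurable_sum => l;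
      exact: bounded_measurable_comp.
  have := second_moment_sum f B (k.+1 ^ 2) mf fB f0.
  have n0 : 0 < (k.+1 ^ 2)%:R :> R by rewrite ltr0n expn_gt0.
  rewrite -natrX; move: n0; set n : R := (k.+1 ^ 2)%:R => n0 H.
  apply: le_trans (_ : n^-1 ^+ 2 * (n * B ^+ 2) <= _).
    by rewrite ler_wpM2l ?sqr_ge0.
  by rewrite le_eqVlt; apply/orP; left; apply/eqP; field; rewrite gt_eqF.
have sum_fin : (\int[Pr]_w \sum_(k <oo) (u k w)%:E < +oo)%E.
  rewrite integral_nneseries// => [|k w _]; last by rewrite lee_fin.
  apply: (@le_lt_trans _ _ (B ^+ 2 * 2)%:E); last exact: ltry.
  apply: lime_le.
    by apply: is_cvg_nneseries => k _ _; apply: integral_ge0 => w _; rewrite lee_fin.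
  apply: nearW => n; rewrite big_mkord.
  under eq_bigr do rewrite mean_EFin//.
  rewrite sumEFin lee_fin.
  apply: le_trans (_ : B ^+ 2 * \sum_(k < n) (k.+1%:R ^+ 2)^-1 <= _).
    by rewrite mulr_sumr; apply: ler_sum => k _.
  by rewrite ler_wpM2l ?sqr_ge0// sum_inv_sqr_le.
have : Pr.-integrable setT (fun w => (\sum_(k <oo) (u k w)%:E)%E).
  apply/integrableP; split.
    apply: (@ge0_emeasurable_sum _ _ _ setT (fun k w => (u k w)%:E) xpredT) => //.
      by move=> k w _ _; rewrite lee_fin.
    by move=> k _; exact: mu.
  apply: le_lt_trans sum_fin; rewrite le_eqVlt; apply/predU1P; left.
  apply: eq_integral => w _.
  by rewrite gee0_abs//; apply: nneseries_ge0 => k _ _; rewrite lee_fin.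
move=> /(integrable_ae measurableT); apply: filterS => w /(_ I) fin_w.
have u_cvg : u k w @[k --> \oo] --> 0.
  apply: cvg_series_cvg_0; apply: nondecreasing_is_cvgn.
    by apply/nondecreasing_seqP => n; rewrite /series/= big_nat_recr//= lerDl.
  exists (fine (\sum_(k <oo) (u k w)%:E)%E) => _ [n _ <-].
  rewrite -lee_fin fineK// /series/= -sumEFin.
  by apply: nneseries_lim_ge => k _ _; rewrite lee_fin.
have := average_cvg_along_squares (fun l => f (X l w)) B (fun l => fB _) u_cvg.
move=> /(cvgD (cvg_cst m)); rewrite addr0; apply: cvg_trans.
apply: near_eq_cvg; near=> n.
have n0 : n%:R != 0 :> R by rewrite pnatr_eq0 -lt0n; near: n; exists 1%N.
rewrite fctE /f big_split/= sumr_const card_ord -[- m *+ _]mulr_natl mulrDr mulrN mulrN.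
by rewrite mulrA mulVf// mul1r addrCA subrr addr0.
Unshelve. all: by end_near. Qed.

End strong_law.

(** * Averaged second-stage multipliers *)

Section averages.
Context {R : realType} {J : nat} {d : measure_display} {T : measurableType d}.
Variables (g : T -> R) (q : T -> 'cV[R]_J) (p0 : R).
Hypotheses (mg : measurable_fun setT g) (g0 : forall t, 0 < g t).
Hypothesis mq : forall i, measurable_fun setT (fun t => q t i 0).
Hypotheses (p0_ge0 : 0 <= p0) (q_le : forall t i, q t i 0 <= p0).
Implicit Types (E : (T -> R) -> R) (eps : R) (x : 'cV[R]_J).

(** What sample averages and expectations have in common; every property of the
averaged multipliers is derived from these four, once for both. *)
Definition averaging E : Prop :=
  [/\ forall f h, bounded_measurable f -> bounded_measurable h ->
        E (fun t => f t + h t) = E f + E h,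
      forall (k : R) f, bounded_measurable f -> E (fun t => k * f t) = k * E f,
      forall f h, bounded_measurable f -> bounded_measurable h ->
        (forall t, f t <= h t) -> E f <= E h &
      forall k : R, E (fun=> k) = k].

Lemma averaging_mean (P : probability T R) :
  averaging (fun f => \int[P]_t f t).
Proof.
split=> [f h bf bh|k f bf|f h bf bh|k].
- exact: meanD.
- exact: meanZ.
- exact: mean_le.
- exact: mean_cst.
Qed.

Lemma averaging_empirical (n : nat) (s : 'I_n -> T) : (0 < n)%N ->
  averaging (fun f : T -> R => n%:R^-1 * \sum_l f (s l)).
Proof.
move=> n0; split=> [f h _ _|k f _|f h _ _ fh|k].
- by rewrite big_split mulrDr.
- by rewrite -mulr_sumr mulrCA.
- by rewrite ler_wpM2l ?invr_ge0// ler_sum.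
- rewrite sumr_const card_ord -[k *+ n]mulr_natl mulrA mulVf ?mul1r//.
  by rewrite pnatr_eq0 -lt0n.
Qed.

Lemma averaging_sum {E} : averaging E -> forall (r : seq 'I_J) (f : 'I_J -> T -> R),
  (forall i, bounded_measurable (f i)) ->
  E (fun t => \sum_(i <- r) f i t) = \sum_(i <- r) E (f i).
Proof.
move=> [ED _ _ Ec] r f bf; elim: r => [|i r IH].
  by under eq_fun do rewrite big_nil; rewrite Ec big_nil.
under eq_fun do rewrite big_cons.
by rewrite ED// ?IH ?big_cons//; exact: bounded_measurable_sum.
Qed.

Lemma averagingB {E} : averaging E -> forall f h,
  bounded_measurable f -> bounded_measurable h ->
  E (fun t => f t - h t) = E f - E h.
Proof.
move=> [ED EZ _ _] f h bf bh.
have bNh : bounded_measurable (fun t => -1 * h t).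
  by apply: bounded_measurableM => //; exact: bounded_measurable_cst.
rewrite -[- E h]mulN1r -EZ// -ED//; congr E.
by apply/funext => t; rewrite mulN1r.
Qed.

Lemma averaging_dist {E} : averaging E -> forall f h (D : R),
  bounded_measurable f -> bounded_measurable h ->
  (forall t, `|f t - h t| <= D) -> `|E f - E h| <= D.
Proof.
move=> aE f h D bf bh fh; rewrite -(averagingB aE)//.
have [_ _ Ele Ec] := aE; have bB := bounded_measurableB bf bh.
rewrite ler_norml; apply/andP; split.
  rewrite -(Ec (- D)); apply: Ele => //; first exact: bounded_measurable_cst.
  by move=> t; have := fh t; rewrite ler_norml => /andP[].
rewrite -[leRHS](Ec D); apply: Ele => //; first exact: bounded_measurable_cst.
by move=> t; have := fh t; rewrite ler_norml => /andP[].
Qed.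

Definition avg_lam E eps x : 'cV[R]_J :=
  \col_i E (fun t => lamsol (g t) eps (q t) x i 0).

Lemma bounded_measurable_lamsol {eps} x i : 0 <= eps ->
  bounded_measurable (fun t => lamsol (g t) eps (q t) x i 0).
Proof.
move=> e0; split; first exact: measurable_lamsol.
by exists p0 => t; rewrite ger0_norm ?lamsol_ge0// lamsol_le.
Qed.

Let nonneg x := forall i, 0 <= x i 0.

Lemma avg_lam_monotone {E eps x x'} : averaging E -> 0 <= eps ->
  nonneg x -> nonneg x' ->
  \sum_i (avg_lam E eps x i 0 - avg_lam E eps x' i 0) * (x i 0 - x' i 0) <= 0.
Proof.
move=> aE e0 x0 x0'; have [ED EZ Ele Ec] := aE.
pose dl i t := lamsol (g t) eps (q t) x i 0 - lamsol (g t) eps (q t) x' i 0.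
have bdl i : bounded_measurable (dl i).
  by apply: bounded_measurableB; exact: bounded_measurable_lamsol.
have bxdl i : bounded_measurable (fun t => (x i 0 - x' i 0) * dl i t).
  by apply: bounded_measurableM => //; exact: bounded_measurable_cst.
have -> : \sum_i (avg_lam E eps x i 0 - avg_lam E eps x' i 0) * (x i 0 - x' i 0) =
    E (fun t => \sum_i (x i 0 - x' i 0) * dl i t).
  rewrite (averaging_sum aE)//; apply: eq_bigr => i _.
  by rewrite EZ// mulrC !mxE -(averagingB aE)//; exact: bounded_measurable_lamsol.
rewrite -[leRHS](Ec 0); apply: Ele.
- exact: bounded_measurable_sum.
- exact: bounded_measurable_cst.
move=> t; under eq_bigr do rewrite mulrC.
by apply: (lam_monotone (ltW (g0 t)) e0);
  exact: (second_stage_sol (q t) _ (g0 t) e0).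
Qed.

Lemma avg_lam_le {E eps x} i : averaging E -> 0 <= eps ->
  avg_lam E eps x i 0 <= p0.
Proof.
move=> [_ _ Ele Ec] e0; rewrite mxE -[leRHS]Ec; apply: Ele.
- exact: bounded_measurable_lamsol.
- exact: bounded_measurable_cst.
- by move=> t; rewrite lamsol_le.
Qed.

(** The second-stage Lipschitz estimate is uniform in the realization, so it
passes to averages. *)
Lemma avg_lam_dist {E eps eps' x x'} {D : R} : averaging E ->
  0 < eps -> 0 <= eps' -> nonneg x -> nonneg x' -> 0 <= D ->
  (forall t, \sum_i (x i 0 - x' i 0 +
     (eps - eps') * lamsol (g t) eps' (q t) x' i 0) ^+ 2 <= (eps * D) ^+ 2) ->
  forall i, `|avg_lam E eps x i 0 - avg_lam E eps' x' i 0| <= D.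
Proof.
move=> aE e0 e0' x0 x0' D0 H i; rewrite !mxE; apply: (averaging_dist aE).
- by apply: bounded_measurable_lamsol; exact: ltW.
- exact: bounded_measurable_lamsol.
move=> t; rewrite -ler_sqr ?nnegrE// real_normK ?num_real//.
rewrite -(ler_pM2l (exprn_gt0 2 e0)) -[leRHS]exprMn; apply: le_trans (H t).
have := lam_lipschitz (ltW (g0 t)) e0
  (second_stage_sol (q t) x (g0 t) (ltW e0) x0)
  (second_stage_sol (q t) x' (g0 t) e0' x0').
apply: le_trans; rewrite ler_wpM2l ?sqr_ge0// (bigD1 i)//= lerDl.
by apply: sumr_ge0 => k _; rewrite sqr_ge0.
Qed.

Lemma exists_first_stage_avg {E eps} (c : 'rV[R]_J) (a : 'cV[R]_J) :
  averaging E -> 0 < eps -> (forall i, 0 < c 0 i) -> (forall i, 0 <= a i 0) ->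
  exists x, first_stage c a (avg_lam E eps) x.
Proof.
move=> aE e0 cpos apos.
apply: (@exists_first_stage _ _ c a (avg_lam E eps) p0 (J%:R / eps ^+ 2)) => //.
- by rewrite divr_ge0// sqr_ge0.
- by move=> x x'; apply: avg_lam_monotone => //; exact: ltW.
- move=> x x' x0 x0'; set S := \sum_i (x i 0 - x' i 0) ^+ 2.
  have S0 : 0 <= S by apply: sumr_ge0 => i _; exact: sqr_ge0.
  apply: (@le_trans _ _ (\sum_(i < J) (Num.sqrt S / eps) ^+ 2)); last first.
    rewrite sumr_const card_ord -[_ *+ J]mulr_natl expr_div_n sqr_sqrtr//.
    by rewrite mulrA mulrAC.
  apply: ler_sum => i _.
  rewrite -(real_normK (num_real (_ - _))) lerXn2r ?nnegrE ?divr_ge0 ?sqrtr_ge0 ?(ltW e0)//.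
  apply: avg_lam_dist; rewrite ?divr_ge0 ?sqrtr_ge0 ?(ltW e0)// => t.
  rewrite mulrC divfK ?gt_eqF// sqr_sqrtr// le_eqVlt; apply/predU1P; left.
  by apply: eq_bigr => k _; rewrite subrr mul0r addr0.
- by move=> x _ i; apply: avg_lam_le => //; exact: ltW.
Qed.

Lemma avg_lam_eps {E eps eps' x} i : averaging E -> 0 < eps -> 0 < eps' ->
  nonneg x ->
  `|avg_lam E eps x i 0 - avg_lam E eps' x i 0| <= J%:R * p0 * `|eps - eps'| / eps.
Proof.
move=> aE e0 e0' x0.
apply: avg_lam_dist; rewrite ?(ltW e0')//.
  by rewrite divr_ge0 ?(ltW e0)// !mulr_ge0.
move=> t; rewrite mulrC divfK ?gt_eqF//.
apply: le_trans (_ : \sum_(k < J) (p0 * `|eps - eps'|) ^+ 2 <= _).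
  apply: ler_sum => k _; rewrite subrr add0r !exprMn real_normK ?num_real// mulrC.
  rewrite ler_wpM2r ?sqr_ge0// lerXn2r ?nnegrE ?lamsol_ge0//.
  by rewrite lamsol_le// ltW.
rewrite sumr_const card_ord -[_ *+ J]mulr_natl -mulrA [leRHS]exprMn.
rewrite ler_wpM2r ?sqr_ge0// -natrX ler_nat.
by case: (J) => // n; rewrite leq_pmull.
Qed.

End averages.

(** * Limits in the sample size and in the regularization parameter *)

Lemma cvg_col {R : realType} {J : nat} {S : Type} {F : set_system S}
    {FF : Filter F} (f : S -> 'cV[R]_J) (x : 'cV[R]_J) :
  (forall i, f s i 0 @[s --> F] --> x i 0) -> f s @[s --> F] --> x.
Proof.
move=> fx; apply/cvg_ballP => e e0.
have : \forall s \near F, forall i, ball (x i 0) e (f s i 0).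
  by apply: filter_forall => i; have /cvg_ballP := fx i; exact.
by apply: filterS => s H; split=> // i j; rewrite ord1; exact: H.
Qed.

Lemma ae_forall_countable {R : realType} {d : measure_display}
    {T : measurableType d} (mu : {measure set T -> \bar R}) {I : countType}
    (Q : I -> T -> Prop) :
  (forall i, {ae mu, forall t, Q i t}) -> {ae mu, forall t, forall i, Q i t}.
Proof.
move=> HQ.
have : {ae mu, forall t, forall n, if @choice.unpickle I n is Some i then Q i t else True}.
  apply: ae_foralln => n; case: (@choice.unpickle I n) => [i|]; first exact: HQ.
  exact: aeW.
by apply: filterS => t H i; have := H (choice.pickle i); rewrite choice.pickleK.
Qed.

Section limits.
Context {R : realType} {J : nat} {d : measure_display} {T : measurableType d}.
Variables (g : T -> R) (q : T -> 'cV[R]_J) (p0 : R).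
Hypotheses (mg : measurable_fun setT g) (g0 : forall t, 0 < g t).
Hypothesis mq : forall i, measurable_fun setT (fun t => q t i 0).
Hypotheses (p0_ge0 : 0 <= p0) (q_le : forall t i, q t i 0 <= p0).
Variables (c : 'rV[R]_J) (a : 'cV[R]_J).
Hypothesis cpos : forall i, 0 < c 0 i.

Lemma first_stage_unique {E eps x x'} : averaging E -> 0 < eps ->
  first_stage c a (avg_lam g q E eps) x -> first_stage c a (avg_lam g q E eps) x' ->
  x = x'.
Proof.
move=> aE e0 Hx Hx'; have [c0 c00 cc0] := exists_pos_lower_bound cpos.
have mono : \sum_i (avg_lam g q E eps x i 0 - avg_lam g q E eps x' i 0) *
    (x i 0 - x' i 0) <= 0.
  apply: (avg_lam_monotone _ _ p0) => //; first exact: ltW.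
    exact: first_stage_ge0 Hx.
  exact: first_stage_ge0 Hx'.
have same k : `|avg_lam g q E eps x' k 0 - avg_lam g q E eps x' k 0| <= 0.
  by rewrite subrr normr0.
apply/colP => i; apply/eqP; rewrite -subr_eq0 -normr_le0.
have := first_stage_stability c00 cc0 mono same Hx Hx' i.
by rewrite mulr0 mul0r.
Qed.

(** A rational eps' near eps links the sample problems at eps to the limit
problem at eps', and that one to the limit problem at eps; in both comparisons
the averages are taken at the solution y of the limit problem at eps', the
point at which they converge. *)
Lemma first_stage_cvg (E0 : (T -> R) -> R) (E : nat -> (T -> R) -> R) (eps : R)
    (xs : nat -> 'cV[R]_J) (x : 'cV[R]_J) :
  averaging E0 -> (forall n, (0 < n)%N -> averaging (E n)) -> 0 < eps ->
  (forall n, (0 < n)%N -> first_stage c a (avg_lam g q (E n) eps) (xs n)) ->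
  first_stage c a (avg_lam g q E0 eps) x ->
  (forall r : rat, 0 < ratr r :> R -> exists2 y,
     first_stage c a (avg_lam g q E0 (ratr r)) y &
     forall i, avg_lam g q (E n) (ratr r) y i 0 @[n --> \oo] -->
               avg_lam g q E0 (ratr r) y i 0) ->
  xs n @[n --> \oo] --> x.
Proof.
move=> aE0 aE e0 Hxs Hx Hr; apply: cvg_col => i; apply/cvgrPdist_le => e epos.
have [c0 c00 cc0] := exists_pos_lower_bound cpos.
(* x and xs n are within J eta / c0 and 2 J eta / c0 of y, which together is
   at most e; del is chosen so that |eps - eps'| <= del moves the averages by at
   most eta. *)
pose eta := e * c0 / (3 * (J%:R + 1)).
have J1 : 0 < J%:R + 1 :> R by rewrite ltr_wpDl.
have eta0 : 0 < eta by rewrite divr_gt0// mulr_gt0.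
pose del := eta * eps / (J%:R * p0 + 1).
have Jp : 0 < J%:R * p0 + 1 by rewrite ltr_wpDl// mulr_ge0.
have del0 : 0 < del by rewrite divr_gt0// mulr_gt0.
have [r /andP[er re]] : exists r : rat, eps < ratr r < eps + del.
  have ed : eps < eps + del by rewrite ltrDl.
  have [r] := rat_in_itvoo ed.
  by rewrite in_itv/=; exists r.
set eps' : R := ratr r in er re *.
have e0' : 0 < eps' by exact: lt_trans er.
have [y Hy y_cvg] := Hr r e0'; rewrite -/eps' in Hy y_cvg.
have y0 := first_stage_ge0 Hy.
have close E1 : averaging E1 -> forall k,
    `|avg_lam g q E1 eps y k 0 - avg_lam g q E1 eps' y k 0| <= eta.
  move=> aE1 k; apply: le_trans (avg_lam_eps _ _ p0 _ _ _ _ _ _ aE1 e0 e0' y0) _ => //.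
  rewrite ler_pdivrMr// distrC ger0_norm; last by rewrite subr_ge0 ltW.
  apply: le_trans (_ : J%:R * p0 * del <= _).
    by rewrite ler_wpM2l ?mulr_ge0// lerBlDl ltW.
  rewrite /del mulrA ler_pdivrMr// mulrC ler_wpM2l//; last by rewrite lerDl.
  by rewrite mulr_ge0// ltW.
have xy : `|x i 0 - y i 0| <= J%:R * eta / c0.
  apply: (first_stage_stability c00 cc0 _ _ Hx Hy i); last exact: close.
  apply: (avg_lam_monotone _ _ p0) => //; first exact: ltW.
  exact: first_stage_ge0 Hx.
have : \forall n \near \oo, forall k,
    `|avg_lam g q (E n) eps' y k 0 - avg_lam g q E0 eps' y k 0| <= eta.
  apply: filter_forall => k.
  have /cvgrPdist_le/(_ _ eta0) := y_cvg k.
  by apply: filterS => n; rewrite distrC.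
move=> Hn; near=> n.
have n0 : (0 < n)%N by near: n; exists 1%N.
have xny : `|xs n i 0 - y i 0| <= J%:R * (eta + eta) / c0.
  apply: (first_stage_stability c00 cc0 _ _ (Hxs n n0) Hy i).
    apply: (avg_lam_monotone _ _ p0) => //; [exact: aE|exact: ltW|].
    exact: first_stage_ge0 (Hxs n n0).
  move=> k; rewrite -(subrKA (avg_lam g q (E n) eps' y k 0)).
  apply: le_trans (ler_normD _ _) _; apply: lerD; first exact: (close _ (aE n n0)).
  by move: k; near: n.
rewrite -(subrKA (y i 0)); apply: le_trans (ler_normD _ _) _.
rewrite (distrC (y i 0)); apply: le_trans (lerD xy xny) _.
rewrite -mulrDl -mulrDr ler_pdivrMr//.
have -> : eta + (eta + eta) = e * c0 / (J%:R + 1).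
  by rewrite /eta; field; rewrite gt_eqF.
rewrite mulrA ler_pdivrMr// mulrC ler_wpM2l ?mulr_ge0 ?(ltW epos) ?(ltW c00)//.
by rewrite lerDl.
Unshelve. all: by end_near. Qed.

(** Comparing the solution at (e n, xs n) with the one at (0, x) bounds
g (y - y_n)^2 by a sum of terms |lam - lam_n| (e n lam_n + |x - xs n|), and both
multipliers lie in [0, p0]. Convergence of lam follows because lam is a
continuous function of y alone, even at eps = 0. *)
Lemma cvg_lamsol (gt : R) (qt : 'cV[R]_J) (e : nat -> R) (xs : nat -> 'cV[R]_J)
    (x : 'cV[R]_J) : 0 < gt -> (forall i, qt i 0 <= p0) ->
  (forall n, 0 <= e n) -> (forall n i, 0 <= xs n i 0) ->
  e n @[n --> \oo] --> (0 : R) ->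
  (forall i, xs n i 0 @[n --> \oo] --> x i 0) -> (forall i, 0 <= x i 0) ->
  forall i, lamsol gt (e n) qt (xs n) i 0 @[n --> \oo] --> lamsol gt 0 qt x i 0.
Proof.
move=> gt0 qp en0 xs0 e_cvg xs_cvg x0.
pose y n := ysol gt (e n) qt (xs n); pose y0 := ysol gt 0 qt x.
pose B n := \sum_i p0 * (e n * p0 + `|x i 0 - xs n i 0|).
have B_cvg : B n @[n --> \oo] --> (0 : R).
  have -> : 0 = \sum_(i < J) p0 * (0 * p0 + 0) :> R.
    by rewrite mul0r addr0 mulr0 big1.
  apply: cvg_sumr => i; apply: cvgMl_tmp; apply: cvgD; first exact: cvgMr_tmp.
  have /cvgrPdist_lt H := xs_cvg i.
  apply/cvgrPdist_lt => eta eta0; have := H _ eta0; apply: filterS => n.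
  by rewrite sub0r normrN normr_id.
have yB n i : gt * (y0 i 0 - y n i 0) ^+ 2 <= B n.
  have S0 := second_stage_sol qt x gt0 (lexx 0) x0.
  have Sn := second_stage_sol qt (xs n) gt0 (en0 n) (xs0 n).
  have := second_stage_monotone (ltW gt0) S0 Sn; rewrite -/y0 -/(y n).
  set S2 := \sum_i (lamsol _ _ _ _ _ _ - _) * _ => H.
  apply: (@le_trans _ _ (- S2)).
    rewrite -subr_le0 opprK; apply: le_trans H; rewrite lerD2r ler_pM2l//.
    by rewrite (bigD1 i)//= lerDl sumr_ge0// => k _; rewrite sqr_ge0.
  rewrite /S2 -sumrN; apply: ler_sum => k _.
  apply: le_trans (ler_norm _) _; rewrite normrN normrM; apply: ler_pM => //.
    have l0 := lamsol_ge0 gt 0 qt x k; have ln := lamsol_ge0 gt (e n) qt (xs n) k.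
    have l0' := lamsol_le k gt0 (lexx 0) p0_ge0 (qp k) (x := x).
    have ln' := lamsol_le k gt0 (en0 n) p0_ge0 (qp k) (x := xs n).
    by rewrite ler_norml; apply/andP; split; lra.
  apply: le_trans (ler_normD _ _) _; rewrite lerD2r mul0r sub0r normrN.
  rewrite ger0_norm; last by rewrite mulr_ge0// lamsol_ge0.
  by rewrite ler_wpM2l// lamsol_le.
have y_cvg i : y n i 0 @[n --> \oo] --> y0 i 0.
  apply/cvgrPdist_lt => eta eta0.
  have ge0' : 0 < gt * eta ^+ 2 by rewrite mulr_gt0// exprn_gt0.
  have /cvgrPdist_lt/(_ _ ge0') := B_cvg; apply: filterS => n.
  rewrite sub0r normrN => /(le_lt_trans (ler_norm _)) Bn.
  rewrite -ltr_sqr ?nnegrE ?(ltW eta0)// real_normK ?num_real//.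
  by rewrite -(ltr_pM2l gt0); exact: le_lt_trans Bn.
have s_cvg : total_supply gt (e n) qt (xs n) @[n --> \oo] --> total_supply gt 0 qt x.
  rewrite -(sum_ysol qt x gt0 (lexx 0)).
  under eq_fun do rewrite -(sum_ysol qt _ gt0 (en0 _)).
  exact: cvg_sumr.
move=> i; rewrite [X in _ --> X]mxE; under eq_fun do rewrite mxE.
have max_cont : continuous (fun u : R => Num.max 0 u).
  apply: (@max_fun_continuous _ _ R (cst 0) id); first exact: cst_continuous.
  by move=> u; exact: cvg_id.
apply: (@continuous_cvg _ _ _ _ _ _ (fun u : R => Num.max 0 u)); first exact: max_cont.
apply: cvgB; last by apply: cvgMl_tmp; exact: y_cvg.
by apply: cvgB; [exact: cvg_cst|apply: cvgMl_tmp].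
Qed.

(** The rate in [cvg_lamsol] is not uniform, since g may be unbounded;
the uniform bound p0 on the multipliers gives dominated convergence. *)
Lemma cvg_mean_lamsol (P : probability T R) (e : nat -> R)
    (xs : nat -> 'cV[R]_J) (x : 'cV[R]_J) :
  (forall n, 0 <= e n) -> (forall n i, 0 <= xs n i 0) ->
  e n @[n --> \oo] --> (0 : R) ->
  (forall i, xs n i 0 @[n --> \oo] --> x i 0) -> (forall i, 0 <= x i 0) ->
  forall i, avg_lam g q (fun f => \int[P]_t f t) (e n) (xs n) i 0 @[n --> \oo] -->
            avg_lam g q (fun f => \int[P]_t f t) 0 x i 0.
Proof.
move=> en0 xs0 e_cvg xs_cvg x0 i.
pose f n t := lamsol (g t) (e n) (q t) (xs n) i 0.
pose f0 t := lamsol (g t) 0 (q t) x i 0.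
have bf n : bounded_measurable (f n).
  exact: (bounded_measurable_lamsol _ _ p0).
have bf0 : bounded_measurable f0.
  exact: (bounded_measurable_lamsol _ _ p0).
have [|||||_ _ ] := @dominated_convergence _ T R P setT measurableT
  (fun n => EFin \o f n) (EFin \o f0) (cst p0%:E).
- by move=> n; apply/measurable_EFinP; case: (bf n).
- by apply/measurable_EFinP; case: bf0.
- apply: aeW => t _; apply: cvg_EFin; first exact: nearW.
  exact: cvg_lamsol.
- by apply: (bounded_integrable P (f := cst p0)); exact: bounded_measurable_cst.
- apply: aeW => t n _; rewrite /= lee_fin ger0_norm ?lamsol_ge0//.
  exact: lamsol_le.
rewrite /= mean_EFin// => H; rewrite mxE; under eq_fun do rewrite mxE.
exact: fine_cvg H.
Qed.

End limits.

(** * Sample average problems and accumulation points *)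

Section samples.
Context {R : realType} {J : nat}.

Definition empirical_mean {T : Type} {n : nat} (s : 'I_n -> T) (f : T -> R) : R :=
  n%:R^-1 * \sum_l f (s l).

Lemma avg_lam_empirical {d : measure_display} {T : measurableType d} (g : T -> R) (q : T -> 'cV[R]_J) {n : nat}
    (s : 'I_n -> T) (eps : R) (x : 'cV[R]_J) :
  avg_lam g q (empirical_mean s) eps x =
  n%:R^-1 *: \sum_l lamsol (g (s l)) eps (q (s l)) x.
Proof. by apply/colP => i; rewrite !mxE summxE. Qed.

(** For eps > 0 the multipliers are determined by x, so the sample average
problem reduces to its first stage. The data gamma, p need to agree with the
regular data g, q only at the sample points. *)
Lemma saa_unique_solution {d : measure_display} {T : measurableType d}
    (g gamma : T -> R) (q p : T -> 'cV[R]_J) (p0 : R)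
    (c : 'rV[R]_J) (a : 'cV[R]_J) {n : nat} (s : 'I_n -> T) (eps : R) x :
  measurable_fun setT g -> (forall t, 0 < g t) ->
  (forall i, measurable_fun setT (fun t => q t i 0)) ->
  0 <= p0 -> (forall t i, q t i 0 <= p0) -> (forall i, 0 < c 0 i) ->
  (0 < n)%N -> 0 < eps ->
  (forall l, gamma (s l) = g (s l)) -> (forall l, p (s l) = q (s l)) ->
  first_stage c a (avg_lam g q (empirical_mean s) eps) x ->
  saa_unique_solution_x c a gamma p eps s x.
Proof.
move=> mg g0 mq p00 qp cpos n0 e0 gE qE Hx.
have x0 := first_stage_ge0 Hx.
have aE : averaging (empirical_mean s) by exact: averaging_empirical.
exists (fun l => ysol (g (s l)) eps (q (s l)) x),
       (fun l => lamsol (g (s l)) eps (q (s l)) x); split.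
  split; first by move: Hx; rewrite /first_stage avg_lam_empirical.
  by move=> l; rewrite gE qE; apply: second_stage_sol => //; exact: ltW.
move=> x' y' lam' [H1 H2].
have x0' : forall i, 0 <= x' i 0 by case: H1.
have [yE lE] : y' = (fun l => ysol (g (s l)) eps (q (s l)) x') /\
               lam' = (fun l => lamsol (g (s l)) eps (q (s l)) x').
  have U l := second_stage_unique (g0 (s l)) e0
    (second_stage_sol (q (s l)) x' (g0 (s l)) (ltW e0) x0').
  split; apply/funext => l; have := H2 l; rewrite gE qE => /U[];
    by move=> ? ?; apply/esym.
have xx : x' = x.
  apply: (first_stage_unique g q p0 mg g0 mq p00 qp c a cpos aE e0 _ Hx).
  by rewrite /first_stage avg_lam_empirical; move: H1; rewrite lE.
by rewrite yE lE xx.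
Qed.

Lemma ae_samples {dO dT : measure_display} {Omega : measurableType dO}
    {T : measurableType dT} {Pr : probability Omega R} {P : probability T R}
    {X : nat -> {RV Pr >-> T}} (G : set T) : iid_samples P X ->
  {ae P, forall t, G t} -> {ae Pr, forall w, forall l, G (X l w)}.
Proof.
move=> [_ XP] [N [mN N0 GN]]; apply: ae_foralln => l; exists (X l @^-1` N); split.
- by rewrite -[X in measurable X]setTI; exact: measurable_funP.
- by rewrite -N0 -(XP l _ mN).
- by move=> w /= GX; apply: GN.
Qed.

End samples.

Lemma measurable_closed_rV {R : realType} {d : nat} (F : set 'rV[R]_d) :
  closed F -> measurable (F : set (borel_rV R d)).
Proof.
move=> cF; rewrite -[F]setCK; apply: measurableC.
by apply: sub_sigma_algebra; exact: closed_openC.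
Qed.

Lemma outer_limit_right0_seq {R : realType} {J : nat} (f : R -> 'cV[R]_J)
    (x : 'cV[R]_J) :
  outer_limit_right0 f x -> exists e : nat -> R,
  [/\ forall n, 0 < e n, e n @[n --> \oo] --> (0 : R) &
      forall i, f (e n) i 0 @[n --> \oo] --> x i 0].
Proof.
move=> fx.
have : forall n : nat, exists e : R, [/\ 0 < e, e < n.+1%:R^-1 &
    forall i, `|x i 0 - f e i 0| < n.+1%:R^-1].
  move=> n; have n0 : 0 < n.+1%:R^-1 :> R by rewrite invr_gt0 ltr0n.
  have near0 : \forall e \near 0^'+, (f @` [set e : R | 0 < e /\ e < n.+1%:R^-1]) (f e).
    apply: filterS2 (nbhs_right_gt (0 : R)) (nbhs_right_lt n0) => e e0 en.
    by exists e.
  have [_ [[e [e0 en] <-] [_ xe]]] := fx _ _ near0 (nbhsx_ballx x _ n0).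
  by exists e; split=> // i; exact: xe.
move=> /choice[e He]; exists e; split=> [n||i]; first by case: (He n).
- apply: (@squeeze_cvgr _ _ _ _ (cst 0) (@harmonic R)).
  + by apply: nearW => n; case: (He n) => /ltW -> /ltW ->.
  + exact: cvg_cst.
  + exact: cvg_harmonic.
- apply/cvgrPdist_lt => eta eta0.
  have /cvgrPdist_lt/(_ _ eta0) := @cvg_harmonic R; apply: filterS => n.
  rewrite sub0r normrN ger0_norm ?harmonic_ge0// => H.
  by apply: lt_trans H; case: (He n).
Qed.

Lemma first_stage_closed {R : realType} {J : nat} (c : 'rV[R]_J) (a : 'cV[R]_J)
    (L : nat -> 'cV[R]_J -> 'cV[R]_J) (L0 : 'cV[R]_J -> 'cV[R]_J)
    (xs : nat -> 'cV[R]_J) (x : 'cV[R]_J) :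
  (forall n, first_stage c a (L n) (xs n)) ->
  (forall i, xs n i 0 @[n --> \oo] --> x i 0) ->
  (forall i, L n (xs n) i 0 @[n --> \oo] --> L0 x i 0) ->
  first_stage c a L0 x.
Proof.
move=> Hxs xs_cvg L_cvg; apply/first_stageP => i.
have H n := (first_stageP _ _ _ _).1 (Hxs n) i.
have F_cvg : c 0 i * xs n i 0 - L n (xs n) i 0 + a i 0 @[n --> \oo] -->
             c 0 i * x i 0 - L0 x i 0 + a i 0.
  apply: cvgD; last exact: cvg_cst.
  by apply: cvgB; [apply: cvgMl_tmp; exact: xs_cvg|exact: L_cvg].
split.
- rewrite -(cvg_lim _ (xs_cvg i))//; apply: limr_ge.
    by apply/cvg_ex; exists (x i 0); exact: xs_cvg.
  by apply: nearW => n; case: (H n).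
- rewrite -(cvg_lim _ F_cvg)//; apply: limr_ge.
    by apply/cvg_ex; eexists; exact: F_cvg.
  by apply: nearW => n; case: (H n).
- have M : xs n i 0 * (c 0 i * xs n i 0 - L n (xs n) i 0 + a i 0) @[n --> \oo] -->
      x i 0 * (c 0 i * x i 0 - L0 x i 0 + a i 0) by exact: cvgM.
  have E n : xs n i 0 * (c 0 i * xs n i 0 - L n (xs n) i 0 + a i 0) = 0.
    by case: (H n).
  rewrite -(cvg_lim _ M)//; under eq_fun do rewrite E.
  exact: lim_cst.
Qed.

Theorem theorem4p3 (R : realType) (d J : nat) (hJ : (1 <= J)%N)
  (P : probability (borel_rV R d) R) (Xi : set (borel_rV R d))
  (hXi : is_support P Xi)
  (c : 'rV[R]_J) (hc : forall j, 0 < c 0 j)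
  (a : 'cV[R]_J) (ha : forall j, 0 < a j 0)
  (p : borel_rV R d -> 'cV[R]_J)
  (hp : forall j, measurable_fun Xi (fun xi => p xi j 0))
  (gamma : borel_rV R d -> R)
  (hgamma : measurable_fun Xi gamma)
  (hgamma_ge0 : forall xi, Xi xi -> 0 <= gamma xi)
  (gamma0 : R) (hgamma0 : 0 < gamma0)
  (hgamma_ge : {ae P, forall xi, Xi xi -> gamma0 <= gamma xi})
  (p0 : R) (hp0 : 0 < p0)
  (hp_le : forall j, {ae P, forall xi, Xi xi -> p xi j 0 <= p0})
  (dO : measure_display) (Omega : measurableType dO) (Pr : probability Omega R)
  (xis : nat -> {RV Pr >-> borel_rV R d})
  (hxis : iid_samples P xis)
  (xsaa : R -> nat -> Omega -> 'cV[R]_J)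
  (hxsaa : forall (eps : R) (nu : nat) (w : Omega) (x : 'cV[R]_J),
     0 < eps -> (1 <= nu)%N ->
     saa_unique_solution_x c a gamma p eps (fun l : 'I_nu => xis l w) x ->
     xsaa eps nu w = x) :
  {ae Pr, forall w : Omega,
    (forall eps : R, 0 < eps -> cvg (xsaa eps nu w @[nu --> \oo])) /\
    outer_limit_right0 (fun eps : R => lim (xsaa eps nu w @[nu --> \oo]))
      `<=` first_stage_solutions P Xi c a gamma p}.
Proof.
have [Xi_closed PXi _] := hXi.
have mXi : measurable Xi by exact: measurable_closed_rV.
have PXiC : P (~` Xi) = 0%E.
  by have := probability_setC P mXi; rewrite PXi subee.
(* Off the full-measure set G the data are replaced by constants, so that the
   bounds and the measurability hold on the whole space; almost surely all samples stay in G. *)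
pose G : set (borel_rV R d) := [set t | [/\ Xi t, gamma0 <= gamma t &
  forall j, p t j 0 <= p0]].
have mG : measurable G.
  have -> : G = (Xi `&` gamma @^-1` `[gamma0, +oo[) `&`
      \bigcap_(j in [set: 'I_J]) (Xi `&` (fun t => p t j 0) @^-1` `]-oo, p0]).
    apply/seteqP; split=> t.
      move=> [Xt gt pt]; split; first by split=> //=; rewrite in_itv/= gt.
      by move=> j _; split=> //=; rewrite in_itv/=.
    move=> [[Xt gt] pt]; split=> //; first by move: gt; rewrite /= in_itv/= andbT.
    by move=> j; have [_] := pt j I; rewrite /= in_itv.
  apply: measurableI; first by apply: hgamma.
  by apply: fin_bigcap_measurable => // j _; apply: hp.
have aeG : {ae P, forall t, G t}.
  have aeXi : {ae P, forall t, Xi t}.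
    by exists (~` Xi); split=> //; exact: measurableC.
  have aep : {ae P, forall t, forall j, Xi t -> p t j 0 <= p0}.
    exact: ae_forall_countable.
  by apply: filterS3 aeXi hgamma_ge aep => t Xt gt pt; split=> // [|j];
    [exact: gt|exact: pt].
pose g t := if t \in G then gamma t else gamma0.
pose q t := if t \in G then p t else 0.
have mtG : measurable_fun setT (fun t : borel_rV R d => t \in G).
  apply: (measurable_fun_bool true); rewrite setTI.
  rewrite (_ : _ @^-1` _ = G)//; apply/seteqP; split=> t /=.
    exact: set_mem.
  exact: mem_set.
have GXi : G `<=` Xi by move=> t [].
have m_if (h : borel_rV R d -> R) (k : R) : measurable_fun Xi h ->
    measurable_fun setT (fun t => if t \in G then h t else k).
  move=> mh; apply: measurable_fun_if => //.
  apply: measurable_funS mXi _ mh => t [_] /= /set_mem; exact: GXi.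
have mg : measurable_fun setT g by exact: m_if.
have mq i : measurable_fun setT (fun t => q t i 0).
  rewrite (_ : (fun t => _) = (fun t => if t \in G then p t i 0 else 0)).
    exact: m_if.
  by apply/funext => t; rewrite /q; case: ifP => // _; rewrite mxE.
have g_ge t : gamma0 <= g t by rewrite /g; case: ifP => // /set_mem[].
have g0 t : 0 < g t by exact: lt_le_trans (g_ge t).
have qp t i : q t i 0 <= p0.
  rewrite /q; case: ifP => [/set_mem[]//|_].
  by rewrite mxE ltW.
have p00 := ltW hp0.
have gE t : G t -> gamma t = g t by move=> Gt; rewrite /g mem_set.
have qE t : G t -> p t = q t by move=> Gt; rewrite /q mem_set.
pose E0 (f : borel_rV R d -> R) := \int[P]_t f t.
have aE0 : averaging E0 by exact: averaging_mean.
have a0 i : 0 <= a i 0 by exact: ltW.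
have /choice[xst Hxst] : forall eps : R, exists x : 'cV[R]_J,
    0 < eps -> first_stage c a (avg_lam g q E0 eps) x.
  move=> eps; have [e0|e0] := ltP 0 eps; last by exists 0.
  by have [x Hx] := exists_first_stage_avg g q p0 mg g0 mq p00 qp c a aE0 e0 hc a0; exists x.
(* The strong law is applied at the solutions for rational parameters, which
   are countably many. *)
have aelaw : {ae Pr, forall w, forall ri : rat * 'I_J, 0 < ratr ri.1 :> R ->
    avg_lam g q (empirical_mean (fun l : 'I_n => xis l w)) (ratr ri.1)
      (xst (ratr ri.1)) ri.2 0 @[n --> \oo] -->
    avg_lam g q E0 (ratr ri.1) (xst (ratr ri.1)) ri.2 0}.
  apply: ae_forall_countable => -[r i] /=.
  have [r0|r0] := ltP 0 (ratr r : R); last first.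
    by apply: aeW.
  have := strong_law_bounded _ _ _ hxis _
    (bounded_measurable_lamsol g q p0 mg g0 mq p00 qp (xst (ratr r)) i (ltW r0)).
  apply: filterS => w H _; rewrite [X in _ --> X]mxE.
  by under eq_fun do rewrite mxE.
apply: filterS2 (ae_samples G hxis aeG) aelaw => w Gw law.
have xsaa_cvg eps : 0 < eps -> xsaa eps nu w @[nu --> \oo] --> xst eps.
  move=> e0.
  apply: (first_stage_cvg g q p0 mg g0 mq p00 qp c a hc E0
    (fun n => empirical_mean (fun l : 'I_n => xis l w)) eps) => //.
  - by move=> n n0; exact: averaging_empirical.
  - move=> n n0.
    have aEn : averaging (@empirical_mean R _ n (fun l : 'I_n => xis l w)).
      exact: averaging_empirical.
    have [x Hx] := exists_first_stage_avg g q p0 mg g0 mq p00 qp c a aEn e0 hc a0.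
    rewrite (hxsaa eps n w x e0 n0)//.
    apply: (saa_unique_solution g gamma q p p0) => // l; [exact: gE|exact: qE].
  - exact: Hxst.
  - by move=> r r0; exists (xst (ratr r)); [exact: Hxst|move=> i; exact: (law (r, i))].
split=> [eps e0|]; first by apply/cvg_ex; exists (xst eps); exact: xsaa_cvg.
move=> x /outer_limit_right0_seq[e [e0 e_cvg x_cvg]].
have limE eps : 0 < eps -> lim (xsaa eps nu w @[nu --> \oo]) = xst eps.
  by move=> eps0; apply: cvg_lim (xsaa_cvg _ eps0); exact: norm_hausdorff.
have xst_cvg i : xst (e n) i 0 @[n --> \oo] --> x i 0.
  by have := x_cvg i; under eq_fun do rewrite limE//.
have xst0 n i : 0 <= xst (e n) i 0 by exact: (first_stage_ge0 (Hxst _ (e0 n))).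
have x0 i : 0 <= x i 0.
  rewrite -(cvg_lim _ (xst_cvg i))//; apply: limr_ge.
    by apply/cvg_ex; exists (x i 0); exact: xst_cvg.
  exact: nearW.
have Hx : first_stage c a (avg_lam g q E0 0) x.
  apply: (first_stage_closed c a (fun n => avg_lam g q E0 (e n)) _ (xst \o e)) => //.
    by move=> n; exact: Hxst.
  by apply: (cvg_mean_lamsol g q p0) => // n; exact: ltW.
have blam i := bounded_measurable_lamsol g q p0 mg g0 mq p00 qp x i (lexx 0).
(* The second-stage witnesses are the explicit solutions at eps = 0. *)
exists (fun t => ysol (g t) 0 (q t) x), (fun t => lamsol (g t) 0 (q t) x); split.
- split=> [j|].
    by apply: measurable_funTS; apply: measurable_ysol.
  exists (p0 / gamma0); apply: aeW => t _ j; rewrite ger0_norm ?ysol_ge0//.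
  apply: le_trans (ysol_le j (g0 t) (lexx 0) p00 (qp t j)) _.
  by rewrite ler_wpM2l// lef_pV2 ?posrE.
- by move=> j; apply: (integrableS measurableT) => //; exact: bounded_integrable.
- suff -> : \col_j \int[P]_(t in Xi) lamsol (g t) 0 (q t) x j 0 =
            avg_lam g q E0 0 x by exact: Hx.
  apply/colP => j; rewrite !mxE /E0 /Rintegral; congr fine.
  rewrite [RHS](negligible_integral (measurableC mXi))//; last first.
    exact: bounded_integrable.
  by rewrite setTD setCK.
- apply: filterS aeG => t Gt _; rewrite (gE t Gt) (qE t Gt).
  exact: second_stage_sol.
Qed.
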